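(* Let $F$ be a smooth closed oriented surface of genus $g\ge1$ with base point $*$ and $H=H_1(F;\mathbb{Z})$. Let $j\in Z^1(\hat{\mathcal{G}}_T;\Lambda^3H)$ be the canonical $\mathcal{M}_{g,*}$-equivariant cocycle defined in the context. Fix a vertex $v_0$ of $\hat{\mathcal{G}}_T$ and for $\varphi\in\mathcal{M}_{g,*}$ set $$\tilde j(\varphi)=\sum_{i=1}^pj(\sigma_i)\in\Lambda^3H,$$ where $\sigma_1,\dots,\sigma_p$ is any chain of oriented $1$-cells of $\hat{\mathcal{G}}_T$ connecting $v_0$ to $\varphi(v_0)$ (the value does not depend on the choice of chain). Then the mapping $\tilde j:\mathcal{M}_{g,*}\to\Lambda^3H$ is a crossed homomorphism, i.e. $\tilde j(\varphi\psi)=\tilde j(\varphi)+\varphi(\tilde j(\psi))$ for all $\varphi,\psi\in\mathcal{M}_{g,*}$, whose restriction to the Torelli group $\mathcal{I}_{g,*}$ is six times the Johnson homomorphism $\tau_1:\mathcal{I}_{g,*}\to\Lambda^3H$.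
   Context: Let $F'=F-\{*\}$, $\mathcal{M}_{g,*}=\pi_0\,\mathrm{Diff}_+(F,* )$ (acting on $H$), and $\mathcal{I}_{g,*}=\ker(\mathcal{M}_{g,*}\to\mathrm{Sp}(2g,\mathbb{Z}))$. The Teichmüller space $\mathcal{T}_{g,*}$ of $F'$ has a canonical $\mathcal{M}_{g,*}$-invariant ideal cell decomposition $\mathcal{G}_T$ whose cells are indexed by isotopy classes of fat graph spines of $F'$ (all vertices of valence $\ge3$); the face relation is induced by collapsing edges with distinct endpoints. $\hat{\mathcal{G}}_T$ is the Poincaré dual cell complex: its vertices are the isotopy classes of trivalent spines; its oriented $1$-cells are the pairs consisting of a trivalent spine $G$ and an edge $e$ of $G$ with distinct endpoints, joining $G$ to the spine obtained by the Whitehead move $W_e$ (collapse $e$, then expand the four-valent vertex in the unique other planar way to a new edge $f$; the reversed $1$-cell is $W_f$); it has one $2$-cell for each class of fat graph spine which is trivalent except for either one five-valent vertex or two four-valent vertices. Homology marking: each oriented edge $a$ of a trivalent spine $G$ determines a class in $H$, also denoted $a$, namely the class of the dual arc $a'$ (from $*$ to $*$), oriented so that the pair of orientations (first $a'$, then $a$) is compatible with the orientation of $F$. Definition of $j$: let $e$ be an edge of $G$ with distinct endpoints, and let $a,b,c,d$ be the other four oriented edge-ends at the endpoints of $e$, all oriented pointing towards $e$, in this cyclic order after collapsing $e$, with $a,b$ incident on one endpoint of $e$ and $c,d$ on the other. Then $j(W_e)=a\wedge b\wedge c=c\wedge d\wedge a\in\Lambda^3H$. This is an $\mathcal{M}_{g,*}$-equivariant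 cellular $1$-cocycle. Johnson homomorphism: $\tau_1:\mathcal{I}_{g,*}\to\Lambda^3H$ is the (first) homomorphism introduced by Johnson. It arises from the action of $\mathcal{I}_{g,*}$ on the nilpotent quotient $\pi/\Gamma_2$ of $\pi=\pi_1(F,* )$, where $\Gamma_1=[\pi,\pi]$ and $\Gamma_2=[\pi,\Gamma_1]$: for $\varphi\in\mathcal{I}_{g,*}$ and $\gamma\in\pi/\Gamma_2$, the element $\varphi(\gamma)\gamma^{-1}$ lies in $\Gamma_1/\Gamma_2$. It is taken with values in $\Lambda^3H$ as in Johnson's work. *)

(* Defs.v *)
From HB Require Import structures.
From mathcomp Require Import all_boot all_order all_algebra.
From mathcomp Require Import generic_quotient.
From mathcomp Require Import all_classical all_reals all_analysis.
From mathcomp Require Import lra.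
From Stdlib Require Import Relation_Operators.

Set Implicit Arguments.
Unset Strict Implicit.
Unset Printing Implicit Defensive.

Import Order.TTheory GRing.Theory Num.Theory.
Import numFieldNormedType.Exports.

Local Open Scope classical_set_scope.
Local Open Scope ring_scope.
Local Open Scope quotient_scope.

(** * Smooth maps *)

Fixpoint Ck (R : realType) (V W : normedModType R) (k : nat)
    (U : set V) (f : V -> W) : Prop :=
  (forall x, U x -> {for x, continuous f}) /\
  if k is k'.+1 then
    forall v : V, (forall x, U x -> derivable f x v) /\
                  Ck k' U (fun x => 'D_v f x)
  else True.

Definition smooth_on (R : realType) (V W : normedModType R)
    (U : set V) (f : V -> W) : Prop := forall k, Ck k U f.

Definition jacdet (R : realType) (f : R * R -> R * R) (p : R * R) : R :=
  let u := 'D_(1, 0) f p in let v := 'D_(0, 1) f p in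
  u.1 * v.2 - u.2 * v.1.

(** * Closed oriented smooth surfaces with a base point *)

Record chart (R : realType) (T : Type) := Chart {
  cdom : set T;
  cmap :> T -> R * R;
  cinv : R * R -> T }.

Definition is_chart (R : realType) (T : topologicalType) (c : chart R T) :=
  [/\ open (cdom c), open (c @` cdom c),
      forall x, cdom c x -> cinv c (c x) = x,
      forall x, cdom c x -> {for x, continuous c} &
      forall p, (c @` cdom c) p -> {for p, continuous (cinv c)}].

Definition compatible (R : realType) (T : topologicalType) (c c' : chart R T) :=
  let U := c @` (cdom c `&` cdom c') in let f := c' \o cinv c in
  smooth_on U f /\ forall p, U p -> 0 < jacdet f p.

Record surface (R : realType) := Surface {
  carrier :> topologicalType;
  base : carrier;
  atlas : set (chart R carrier);
  surface_hausdorff : hausdorff_space carrier;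
  surface_compact : compact [set: carrier];
  surface_connected : connected [set: carrier];
  atlas_chart : forall c, atlas c -> is_chart c;
  atlas_cover : forall x, exists2 c, atlas c & cdom c x;
  atlas_compatible : forall c c', atlas c -> atlas c' -> compatible c c';
  atlas_maximal : forall c, is_chart c ->
    (forall c', atlas c' -> compatible c c' /\ compatible c' c) -> atlas c }.
Arguments base {R} s.
Arguments atlas {R} s _.

(** * The fundamental group *)

(* A loop is parametrized by the whole line and rests at the base point outside
   the unit interval. *)
Record loop (R : realType) (F : surface R) := Loop {
  lfun :> R -> F;
  loop_cont : continuous lfun;
  loop_le0 : forall t, t <= 0 -> lfun t = base F;
  loop_ge1 : forall t, 1 <= t -> lfun t = base F }.

Section FundamentalGroup.
Context {R : realType} {F : surface R}.
Implicit Types f g h : loop F.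

HB.instance Definition _ := gen_eqMixin (loop F).
HB.instance Definition _ := gen_choiceMixin (loop F).

Definition homotopic f g : Prop :=
  exists H : R * R -> F, [/\ continuous H,
    forall t, H (0, t) = f t, forall t, H (1, t) = g t &
    forall s t, t <= 0 \/ 1 <= t -> H (s, t) = base F].

Lemma cst_loop_cont : continuous (fun _ : R => base F).
Proof. by move=> x; exact: cvg_cst. Qed.
Definition cst_loop : loop F :=
  Loop cst_loop_cont (fun _ _ => erefl) (fun _ _ => erefl).

Lemma glue_cont (T : topologicalType) (p : T -> R) (u v : T -> F) :
  continuous p -> continuous u -> continuous v ->
  (forall x, p x = 2^-1 -> u x = v x) ->
  continuous (fun x => if p x <= 2^-1 then u x else v x).
Proof.
move=> cp cu cv uv.
pose A := p @^-1` [set x | x <= 2^-1]; pose B := p @^-1` [set x | x >= 2^-1].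
have AB : A `|` B = setT.
  by apply/seteqP; split=> x // _; rewrite /A /B /=; case: (leP (p x) 2^-1);
    [left|move=> /ltW; right].
have cA : closed A by apply: preimage_closed => //; exact: closed_le.
have cB : closed B by apply: preimage_closed => //; exact: closed_ge.
pose w x := if p x <= 2^-1 then u x else v x; rewrite -/w.
have uw : {in A, u =1 w} by move=> x /set_mem Ax; rewrite /w; case: ifPn => // /negP.
have vw : {in B, v =1 w}.
  move=> x /set_mem Bx; rewrite /w; case: ifPn => // pA.
  by apply/esym/uv/le_anti/andP.
have : {within A `|` B, continuous w}.
  apply: withinU_continuous => //.
    exact: subspace_eq_continuous uw (continuous_subspaceT cu).
  exact: subspace_eq_continuous vw (continuous_subspaceT cv).
by rewrite AB -continuous_subspace_setT.
Qed.

Lemma loop_comp (T : topologicalType) (p : T -> R) f :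
  continuous p -> continuous (fun x => f (p x)).
Proof. by move=> cp x; apply: continuous_comp (cp x) (@loop_cont _ _ f _). Qed.

Lemma double_cont : continuous (fun t : R => 2 * t).
Proof. by move=> t; apply: cvgM; [exact: cvg_cst|exact: cvg_id]. Qed.

Lemma doubleB_cont : continuous (fun t : R => 2 * t - 1).
Proof. by move=> t; apply: cvgB; [exact: double_cont|exact: cvg_cst]. Qed.

Lemma onem_cont : continuous (fun t : R => 1 - t).
Proof. by move=> t; apply: cvgB; [exact: cvg_cst|exact: cvg_id]. Qed.

Definition cat_fun f g (t : R) : F :=
  if t <= 2^-1 then f (2 * t) else g (2 * t - 1).

Lemma cat_cont f g : continuous (cat_fun f g).
Proof.
apply: (@glue_cont _ id (fun t => f (2 * t)) (fun t => g (2 * t - 1))).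
- by move=> t; exact: cvg_id.
- exact: loop_comp double_cont.
- exact: loop_comp doubleB_cont.
- by move=> t ->; rewrite divff // subrr loop_ge1 // loop_le0.
Qed.

Lemma cat_le0 f g t : t <= 0 -> cat_fun f g t = base F.
Proof. by move=> t0; rewrite /cat_fun ifT ?loop_le0 //; lra. Qed.

Lemma cat_ge1 f g t : 1 <= t -> cat_fun f g t = base F.
Proof.
move=> t1; rewrite /cat_fun ifF ?loop_ge1 //; first lra.
by apply/negbTE; rewrite -ltNge; lra.
Qed.

Definition cat_loop f g : loop F :=
  Loop (@cat_cont f g) (@cat_le0 f g) (@cat_ge1 f g).

Lemma rev_le0 f t : t <= 0 -> f (1 - t) = base F.
Proof. by move=> t0; rewrite loop_ge1 //; lra. Qed.

Lemma rev_ge1 f t : 1 <= t -> f (1 - t) = base F.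
Proof. by move=> t0; rewrite loop_le0 //; lra. Qed.

Definition rev_loop f : loop F :=
  Loop (loop_comp onem_cont) (@rev_le0 f) (@rev_ge1 f).

Definition clamp (s : R) : R := Num.max 0 (Num.min 1 s).

Lemma min_cont (u v : R -> R) : continuous u -> continuous v ->
  continuous (fun t => Num.min (u t) (v t)).
Proof. by move=> cu cv t; apply: continuous_min; [exact: cu|exact: cv]. Qed.

Lemma max_cont (u v : R -> R) : continuous u -> continuous v ->
  continuous (fun t => Num.max (u t) (v t)).
Proof. by move=> cu cv t; apply: continuous_max; [exact: cu|exact: cv]. Qed.

Lemma clamp_cont : continuous clamp.
Proof.
apply: max_cont; first by move=> ?; exact: cvg_cst.
by apply: min_cont => ?; [exact: cvg_cst|exact: cvg_id].
Qed.

Lemma clamp01 s : 0 <= clamp s <= 1.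
Proof. by rewrite /clamp le_max lexx /= ge_max ler01 ge_min lexx. Qed.

Lemma clamp0 : clamp 0 = 0.
Proof. by rewrite /clamp min_r ?ler01 // maxxx. Qed.
Lemma clamp1 : clamp 1 = 1.
Proof. by rewrite /clamp minxx max_r ?ler01. Qed.

Lemma homotopic_comp f g h (p q : R -> R) :
  continuous p -> continuous q ->
  (forall t, t <= 0 -> (p t <= 0 /\ q t <= 0) \/ (1 <= p t /\ 1 <= q t)) ->
  (forall t, 1 <= t -> (p t <= 0 /\ q t <= 0) \/ (1 <= p t /\ 1 <= q t)) ->
  (forall t, g t = f (p t)) -> (forall t, h t = f (q t)) -> homotopic g h.
Proof.
move=> cp cq le0 ge1 gE hE.
exists (fun x => f ((1 - clamp x.1) * p x.2 + clamp x.1 * q x.2)); split.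
- apply: loop_comp => x; apply: cvgD; apply: cvgM.
  + apply: cvgB; first exact: cvg_cst.
    exact: (@continuous_comp _ _ _ fst clamp x cvg_fst (@clamp_cont _)).
  + exact: (@continuous_comp _ _ _ snd p x cvg_snd (@cp _)).
  + exact: (@continuous_comp _ _ _ fst clamp x cvg_fst (@clamp_cont _)).
  + exact: (@continuous_comp _ _ _ snd q x cvg_snd (@cq _)).
- by move=> t; rewrite /= clamp0 subr0 mul1r mul0r addr0.
- by move=> t; rewrite /= clamp1 subrr mul0r mul1r add0r.
- move=> s t t01 /=; have /andP[c0 c1] := clamp01 s.
  have /orP : ((p t <= 0) && (q t <= 0)) || ((1 <= p t) && (1 <= q t)).
    by apply/orP; case: t01 => [/le0|/ge1] [] [-> ->]; [left|right|left|right].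
  case=> /andP[pt qt]; [rewrite loop_le0 //|rewrite loop_ge1 //].
    by rewrite -[leRHS]addr0 lerD // mulr_ge0_le0 // subr_ge0.
  nra.
Qed.

Lemma homotopic_refl f : homotopic f f.
Proof.
by apply: (@homotopic_comp f f f id id) => // [t|t|t t0|t t1];
  do ?exact: cvg_id; [left|right].
Qed.

Lemma pair_cont (T U V : topologicalType) (p : T -> U) (q : T -> V) :
  continuous p -> continuous q -> continuous (fun x => (p x, q x)).
Proof.
by move=> cp cq x; apply: (@cvg_pair _ _ _ _ (nbhs (p x)) (nbhs (q x)));
  [exact: cp|exact: cq].
Qed.

Lemma square_comp (H : R * R -> F) (p q : R * R -> R) :
  continuous H -> continuous p -> continuous q ->
  continuous (fun x => H (p x, q x)).
Proof.
move=> cH cp cq x.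
exact: (@continuous_comp _ _ _ (fun x => (p x, q x)) H x
  (@pair_cont _ _ _ p q cp cq x) (@cH _)).
Qed.

Lemma fst_cont (p : R -> R) : continuous p -> continuous (fun x : R * R => p x.1).
Proof. by move=> cp x; exact: (@continuous_comp _ _ _ fst p x cvg_fst (@cp _)). Qed.

Lemma snd_cont (p : R -> R) : continuous p -> continuous (fun x : R * R => p x.2).
Proof. by move=> cp x; exact: (@continuous_comp _ _ _ snd p x cvg_snd (@cp _)). Qed.

Lemma idR_cont : continuous (@id R).
Proof. by move=> x; exact: cvg_id. Qed.

Lemma homotopic_sym f g : homotopic f g -> homotopic g f.
Proof.
case=> H [cH H0 H1 Hb]; exists (fun x => H (1 - x.1, x.2)); split.
- exact: square_comp cH (fst_cont onem_cont) (snd_cont idR_cont).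
- by move=> t; rewrite /= subr0.
- by move=> t; rewrite /= subrr.
- by move=> s t t01; exact: Hb.
Qed.

Lemma homotopic_trans f g h : homotopic f g -> homotopic g h -> homotopic f h.
Proof.
case=> H [cH H0 H1 Hb] [K [cK K0 K1 Kb]].
exists (fun x => if x.1 <= 2^-1 then H (2 * x.1, x.2) else K (2 * x.1 - 1, x.2)).
split.
- apply: (@glue_cont _ fst (fun x => H (2 * x.1, x.2))
    (fun x => K (2 * x.1 - 1, x.2))).
  + exact: (fst_cont idR_cont).
  + exact: square_comp cH (fst_cont double_cont) (snd_cont idR_cont).
  + exact: square_comp cK (fst_cont doubleB_cont) (snd_cont idR_cont).
  + by move=> x ->; rewrite divff // subrr H1 K0.
- by move=> t /=; rewrite ifT ?mulr0 //; lra.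
- move=> t /=; rewrite ifF ?mulr1; last by apply/negbTE; rewrite -ltNge; lra.
  by rewrite (_ : 2 - 1 = 1) //; lra.
- by move=> s t t01 /=; case: ifP => _; [exact: Hb|exact: Kb].
Qed.

Lemma homotopic_cat f f' g g' : homotopic f f' -> homotopic g g' ->
  homotopic (cat_loop f g) (cat_loop f' g').
Proof.
case=> H [cH H0 H1 Hb] [K [cK K0 K1 Kb]].
exists (fun x => if x.2 <= 2^-1 then H (x.1, 2 * x.2) else K (x.1, 2 * x.2 - 1)).
split.
- apply: (@glue_cont _ snd (fun x => H (x.1, 2 * x.2))
    (fun x => K (x.1, 2 * x.2 - 1))).
  + exact: (snd_cont idR_cont).
  + exact: square_comp cH (fst_cont idR_cont) (snd_cont double_cont).
  + exact: square_comp cK (fst_cont idR_cont) (snd_cont doubleB_cont).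
  + by move=> x ->; rewrite divff // subrr Hb ?Kb //; [left|right].
- by move=> t; rewrite /= /cat_fun H0 K0.
- by move=> t; rewrite /= /cat_fun H1 K1.
- move=> s t t01 /=; case: ifP => [l|/negbT].
    by rewrite Hb//; left; case: t01; lra.
  by rewrite -ltNge => l; rewrite Kb//; right; case: t01; lra.
Qed.

Lemma homotopic_rev f g : homotopic f g -> homotopic (rev_loop f) (rev_loop g).
Proof.
case=> H [cH H0 H1 Hb]; exists (fun x => H (x.1, 1 - x.2)); split.
- exact: square_comp cH (fst_cont idR_cont) (snd_cont onem_cont).
- by move=> t; rewrite /= H0.
- by move=> t; rewrite /= H1.
- by move=> s t t01 /=; apply: Hb; case: t01; [right|left]; lra.
Qed.

Lemma cat_loop0f f : homotopic (cat_loop cst_loop f) f.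
Proof.
apply: (@homotopic_comp f _ _ (fun t => 2 * t - 1) id).
- exact: doubleB_cont.
- exact: idR_cont.
- by move=> t t0; left; split; lra.
- by move=> t t1; right; split; lra.
- move=> t; rewrite /= /cat_fun; case: ifP => // t2.
  by rewrite (@loop_le0 _ _ f) //; lra.
- by [].
Qed.

Lemma cat_loopf0 f : homotopic (cat_loop f cst_loop) f.
Proof.
apply: (@homotopic_comp f _ _ (fun t => 2 * t) id).
- exact: double_cont.
- exact: idR_cont.
- by move=> t t0; left; split; lra.
- by move=> t t1; right; split; lra.
- move=> t; rewrite /= /cat_fun; case: ifPn => //; rewrite -ltNge => t2.
  by rewrite (@loop_ge1 _ _ f) //; lra.
- by [].
Qed.

Lemma cat_loopVf f : homotopic (cat_loop (rev_loop f) f) cst_loop.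
Proof.
apply: (@homotopic_comp f _ _ (fun t => Num.max (1 - 2 * t) (2 * t - 1)) (cst 1)).
- apply: max_cont; last exact: doubleB_cont.
  by move=> t; apply: cvgB; [exact: cvg_cst|exact: double_cont].
- by move=> t; exact: cvg_cst.
- by move=> t t0; right; split => //; rewrite le_max; apply/orP; left; lra.
- by move=> t t1; right; split => //; rewrite le_max; apply/orP; right; lra.
- move=> t; rewrite /= /cat_fun; case: ifPn => [t2|].
    by rewrite /= max_l //; lra.
  by rewrite -ltNge => t2; rewrite max_r //; lra.
- by move=> t; rewrite /= loop_ge1.
Qed.

Lemma cat_loopfV f : homotopic (cat_loop f (rev_loop f)) cst_loop.
Proof.
apply: (@homotopic_comp f _ _ (fun t => Num.min (2 * t) (2 - 2 * t)) (cst 0)).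
- apply: min_cont; first exact: double_cont.
  by move=> t; apply: cvgB; [exact: cvg_cst|exact: double_cont].
- by move=> t; exact: cvg_cst.
- by move=> t t0; left; split => //; rewrite ge_min; apply/orP; left; lra.
- by move=> t t1; left; split => //; rewrite ge_min; apply/orP; right; lra.
- move=> t; rewrite /= /cat_fun; case: ifPn => [t2|].
    by rewrite /= min_l //; lra.
  rewrite -ltNge => t2; rewrite /= min_r; last lra.
  by congr (lfun f _); lra.
- by move=> t; rewrite /= loop_le0.
Qed.

Lemma cat_loopA f g h :
  homotopic (cat_loop f (cat_loop g h)) (cat_loop (cat_loop f g) h).
Proof.
pose p t : R := Num.min (2 * t) (Num.min (t + 4^-1) (2^-1 * t + 2^-1)).
apply: (@homotopic_comp (cat_loop f (cat_loop g h)) _ _ id p).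
- exact: idR_cont.
- apply: min_cont; first exact: double_cont.
  apply: min_cont => t; apply: cvgD; try exact: cvg_cst; first exact: cvg_id.
  by apply: cvgM; [exact: cvg_cst|exact: cvg_id].
- by move=> t t0; left; split => //; rewrite /p ge_min; apply/orP; left; lra.
- by move=> t t1; right; split => //; rewrite /p !le_min; apply/and3P; split; lra.
- by [].
move=> t; rewrite /= {1}/cat_fun /= /cat_fun.
have [t2|t2] := leP t 2^-1; last first.
  have -> : p t = 2^-1 * t + 2^-1 by rewrite /p (@min_r _ _ (t + _)) ?min_r //; lra.
  rewrite ifF; last by apply/negbTE; rewrite -ltNge; lra.
  rewrite /= /cat_fun ifF; last by apply/negbTE; rewrite -ltNge; lra.
  by congr (lfun h _); lra.
have [t4|t4] := leP (2 * t) 2^-1.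
  have -> : p t = 2 * t by rewrite /p min_l // le_min; apply/andP; split; lra.
  by rewrite ifT.
have -> : p t = t + 4^-1 by rewrite /p (@min_l _ _ (t + _)) ?min_r //; lra.
rewrite ifF; last by apply/negbTE; rewrite -ltNge; lra.
rewrite /= /cat_fun ifT; last by lra.
by congr (lfun g _); lra.
Qed.

Definition homotopicb f g : bool := `[< homotopic f g >].

Lemma homotopicb_equiv : equiv_class_of homotopicb.
Proof.
split=> [f|f g|g f h].
- exact/asboolP/homotopic_refl.
- by apply/asboolP/asboolP; exact: homotopic_sym.
- by move=> /asboolP fg /asboolP gh; apply/asboolP; exact: homotopic_trans gh.
Qed.
Canonical homotopic_equiv := EquivRelPack homotopicb_equiv.

Definition pi1 := {eq_quot homotopic_equiv}.

End FundamentalGroup.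
Arguments pi1 {R} F.

Section FundamentalGroupTheory.
Context {R : realType} {F : surface R}.
Implicit Types (f g h : loop F) (x y z : pi1 F).
HB.instance Definition _ := Choice.on (pi1 F).
HB.instance Definition _ := EqQuotient.on (pi1 F).

Definition cls f : pi1 F := \pi_(pi1 F) f.

Lemma clsP f g : reflect (homotopic f g) (cls f == cls g).
Proof. by rewrite /cls eqmodE; exact: asboolP. Qed.

Lemma cls_eq f g : homotopic f g -> cls f = cls g.
Proof. by move=> /clsP/eqP. Qed.

Lemma repr_cls f : homotopic (repr (cls f)) f.
Proof. by apply/clsP; rewrite /cls reprK. Qed.

Lemma clsK x : cls (repr x) = x. Proof. exact: reprK. Qed.

(* x * y runs first through x and then through y *)
Definition pi1_mul x y := cls (cat_loop (repr x) (repr y)).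
Definition pi1_inv x := cls (rev_loop (repr x)).

Lemma cls_cat f g : cls (cat_loop f g) = pi1_mul (cls f) (cls g).
Proof. by apply/esym/cls_eq/homotopic_cat; exact: repr_cls. Qed.

Lemma cls_rev f : cls (rev_loop f) = pi1_inv (cls f).
Proof. by apply/esym/cls_eq/homotopic_rev; exact: repr_cls. Qed.

Lemma pi1_mulA : associative pi1_mul.
Proof.
move=> x y z; rewrite -(clsK x) -(clsK y) -(clsK z) -!cls_cat.
exact/cls_eq/cat_loopA.
Qed.
Lemma pi1_mul1 : left_id (cls cst_loop) pi1_mul.
Proof. by move=> x; rewrite -(clsK x) -!cls_cat; exact/cls_eq/cat_loop0f. Qed.
Lemma pi1_mulr1 : right_id (cls cst_loop) pi1_mul.
Proof. by move=> x; rewrite -(clsK x) -!cls_cat; exact/cls_eq/cat_loopf0. Qed.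
Lemma pi1_mulV : left_inverse (cls cst_loop) pi1_inv pi1_mul.
Proof.
by move=> x; rewrite -(clsK x) -cls_rev -cls_cat; exact/cls_eq/cat_loopVf.
Qed.
Lemma pi1_mulrV : right_inverse (cls cst_loop) pi1_inv pi1_mul.
Proof.
by move=> x; rewrite -(clsK x) -cls_rev -cls_cat; exact/cls_eq/cat_loopfV.
Qed.

HB.instance Definition _ := isGroup.Build (pi1 F)
  pi1_mulA pi1_mul1 pi1_mulr1 pi1_mulV pi1_mulrV.

End FundamentalGroupTheory.

(** * Lower central series and abelianization *)

Section Groups.
Context {G : groupType}.
Implicit Types x y z : G.
Local Open Scope group_scope.

Inductive generated (S : set G) : set G :=
| gen_in x : S x -> generated S x
| gen_1 : generated S 1
| gen_mul x y : generated S x -> generated S y -> generated S (x * y)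
| gen_inv x : generated S x -> generated S x^-1.

Definition bracket x y : G := x * y * x^-1 * y^-1.

Fixpoint lcs (k : nat) : set G :=
  if k is k'.+1 then
    generated [set z | exists x y, lcs k' y /\ z = bracket x y]
  else setT.

Definition zexpg x (n : int) : G :=
  match n with Posz k => x ^+ k | Negz k => x ^- k.+1 end.

Lemma bracket_lcs1 x y : lcs 1 (bracket x y).
Proof. by apply: gen_in; exists x, y. Qed.

Lemma conj_lcs1 x c : lcs 1 c -> lcs 1 (x * c * x^-1).
Proof.
move=> c1; rewrite (_ : _ * _ = bracket x c * c); last by rewrite /bracket mulgVK.
by apply: gen_mul => //; exact: bracket_lcs1.
Qed.

Definition abrel x y : bool := `[< lcs 1 (x * y^-1) >].

Lemma abrel_equiv : equiv_class_of abrel.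
Proof.
split=> [x|x y|y x z].
- by apply/asboolP; rewrite mulgV; exact: gen_1.
- by apply/asboolP/asboolP => /gen_inv; rewrite invgF.
- move=> /asboolP xy /asboolP yz; apply/asboolP.
  by have := gen_mul xy yz; rewrite mulgA mulgVK.
Qed.
Canonical abrel_canonical := EquivRelPack abrel_equiv.

Definition ab := {eq_quot abrel_canonical}.
End Groups.
Arguments ab G : clear implicits.

Section Abelianization.
Context {G : groupType}.
Implicit Types (x y z : G) (u v : ab G).
HB.instance Definition _ := Choice.on (ab G).
HB.instance Definition _ := EqQuotient.on (ab G).
Local Open Scope group_scope.

Definition abcls x : ab G := \pi_(ab G) x.

Lemma abcls_eq x y : lcs 1 (x * y^-1) -> abcls x = abcls y.
Proof. by move=> xy; apply/eqP; rewrite /abcls eqmodE; apply/asboolP. Qed.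

Lemma repr_abcls x : lcs 1 (repr (abcls x) * x^-1).
Proof.
have /eqP : abcls (repr (abcls x)) = abcls x by exact: reprK.
by rewrite /abcls eqmodE => /asboolP.
Qed.

Lemma abclsK u : abcls (repr u) = u. Proof. exact: reprK. Qed.

Definition ab_add u v := abcls (repr u * repr v).
Definition ab_opp u := abcls (repr u)^-1.

Lemma abclsM x y : abcls (x * y) = ab_add (abcls x) (abcls y).
Proof.
apply/esym/abcls_eq; rewrite invgM mulgA.
set a := repr _; set b := repr _.
rewrite (_ : a * b * y^-1 * x^-1 = (a * (b * y^-1) * a^-1) * (a * x^-1)); last first.
  by rewrite !mulgA mulgVK.
by apply: gen_mul; [apply: conj_lcs1|]; exact: repr_abcls.
Qed.

Lemma abclsV x : abcls x^-1 = ab_opp (abcls x).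
Proof.
apply/abcls_eq; rewrite invgK; set a := repr _.
rewrite (_ : x^-1 * a = x^-1 * (a * x^-1) * x^-1^-1); last by rewrite invgK mulgA mulgVK.
exact/conj_lcs1/repr_abcls.
Qed.

Lemma ab_addA : associative ab_add.
Proof. by move=> u v w; rewrite -(abclsK u) -(abclsK v) -(abclsK w) -!abclsM mulgA. Qed.
Lemma ab_addC : commutative ab_add.
Proof.
move=> u v; rewrite -(abclsK u) -(abclsK v) -!abclsM; apply: abcls_eq.
by rewrite invgM mulgA; exact: bracket_lcs1.
Qed.
Lemma ab_add0 : left_id (abcls 1) ab_add.
Proof. by move=> u; rewrite -(abclsK u) -abclsM mul1g. Qed.
Lemma ab_addN : left_inverse (abcls 1) ab_opp ab_add.
Proof. by move=> u; rewrite -(abclsK u) -abclsV -abclsM mulVg. Qed.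

HB.instance Definition _ :=
  GRing.isZmodule.Build (ab G) ab_addA ab_addC ab_add0 ab_addN.

End Abelianization.

(** * Third exterior power *)

Definition alternating3 (V A : zmodType) (f : V -> V -> V -> A) : Prop :=
  [/\ forall x x' y z, f (x + x') y z = f x y z + f x' y z,
      forall x y y' z, f x (y + y') z = f x y z + f x y' z,
      forall x y z z', f x y (z + z') = f x y z + f x y z',
      forall x z, f x x z = 0 & forall x y, f x y y = 0].

Definition sum3 (V A : zmodType) (f : V -> V -> V -> A) (s : seq (V * V * V)) : A :=
  \sum_(p <- s) f p.1.1 p.1.2 p.2.

(* Formal sums of decomposable trivectors, two of them being equal when every
   alternating trilinear map takes the same value on both; the opposite of a
   decomposable trivector is again decomposable. *)
Section Ext3.
Context {V : zmodType}.
Implicit Types s t : seq (V * V * V).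

Definition ext3_rel s t : bool :=
  `[< forall (A : zmodType) (f : V -> V -> V -> A),
        alternating3 f -> sum3 f s = sum3 f t >].

Lemma ext3_equiv : equiv_class_of ext3_rel.
Proof.
split=> [s|s t|t s u].
- by apply/asboolP.
- by apply/asboolP/asboolP => st A f fA; rewrite st.
- by move=> /asboolP st /asboolP tu; apply/asboolP => A f fA; rewrite st // tu.
Qed.
Canonical ext3_canonical := EquivRelPack ext3_equiv.

Definition ext3 := {eq_quot ext3_canonical}.
End Ext3.
Arguments ext3 V : clear implicits.

Section Ext3Theory.
Context {V : zmodType}.
Implicit Types (s t : seq (V * V * V)) (u v w : ext3 V).
HB.instance Definition _ := Choice.on (ext3 V).
HB.instance Definition _ := EqQuotient.on (ext3 V).

Definition ext3_cls s : ext3 V := \pi_(ext3 V) s.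

Lemma ext3_clsP s t :
  ext3_cls s = ext3_cls t <->
  forall (A : zmodType) (f : V -> V -> V -> A),
    alternating3 f -> sum3 f s = sum3 f t.
Proof.
split=> [/eqP|st]; first by rewrite /ext3_cls eqmodE => /asboolP.
by apply/eqP; rewrite /ext3_cls eqmodE; apply/asboolP.
Qed.

Lemma ext3_clsK u : ext3_cls (repr u) = u. Proof. exact: reprK. Qed.

Definition neg3 s := [seq (- p.1.1, p.1.2, p.2) | p <- s].

Lemma sum3_neg (A : zmodType) (f : V -> V -> V -> A) s :
  alternating3 f -> sum3 f (neg3 s) = - sum3 f s.
Proof.
case=> fD _ _ _ _; rewrite /sum3 big_map -sumrN; apply: eq_bigr => p _ /=.
apply/eqP; rewrite -addr_eq0 -fD addNr.
by have := fD 0 0 p.1.2 p.2; rewrite addr0 => /eqP; rewrite -subr_eq subrr eq_sym.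
Qed.

Lemma sum3_cat (A : zmodType) (f : V -> V -> V -> A) s t :
  sum3 f (s ++ t) = sum3 f s + sum3 f t.
Proof. by rewrite /sum3 big_cat. Qed.

Definition ext3_add u v := ext3_cls (repr u ++ repr v).
Definition ext3_opp u := ext3_cls (neg3 (repr u)).

Lemma ext3_clsD s t : ext3_cls (s ++ t) = ext3_add (ext3_cls s) (ext3_cls t).
Proof.
apply/ext3_clsP => A f fA; rewrite !sum3_cat.
by congr (_ + _); move: A f fA; apply/ext3_clsP; rewrite ext3_clsK.
Qed.

Lemma ext3_clsN s : ext3_cls (neg3 s) = ext3_opp (ext3_cls s).
Proof.
apply/ext3_clsP => A f fA; rewrite !sum3_neg //.
by congr (- _); move: A f fA; apply/ext3_clsP; rewrite ext3_clsK.
Qed.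

Lemma ext3_addA : associative ext3_add.
Proof.
by move=> u v w; rewrite -(ext3_clsK u) -(ext3_clsK v) -(ext3_clsK w) -!ext3_clsD catA.
Qed.
Lemma ext3_addC : commutative ext3_add.
Proof.
move=> u v; rewrite -(ext3_clsK u) -(ext3_clsK v) -!ext3_clsD.
by apply/ext3_clsP => A f fA; rewrite !sum3_cat addrC.
Qed.
Lemma ext3_add0 : left_id (ext3_cls [::]) ext3_add.
Proof. by move=> u; rewrite -(ext3_clsK u) -!ext3_clsD. Qed.
Lemma ext3_addN : left_inverse (ext3_cls [::]) ext3_opp ext3_add.
Proof.
move=> u; rewrite -(ext3_clsK u) -!ext3_clsN -!ext3_clsD.
by apply/ext3_clsP => A f fA; rewrite !sum3_cat sum3_neg // addNr /sum3 big_nil.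
Qed.

HB.instance Definition _ :=
  GRing.isZmodule.Build (ext3 V) ext3_addA ext3_addC ext3_add0 ext3_addN.

Definition wedge3 (x y z : V) : ext3 V := ext3_cls [:: (x, y, z)].

Lemma wedge3_alternating : alternating3 wedge3.
Proof.
have D s t : ext3_cls (s ++ t) = ext3_cls s + ext3_cls t by exact: ext3_clsD.
split=> [x x' y z|x y y' z|x y z z'|x z|x y]; rewrite /wedge3 -?D;
  apply/ext3_clsP => A f [f1 f2 f3 f4 f5];
  by rewrite /sum3 /= ?big_cons ?big_nil ?addr0 /= ?f1 ?f2 ?f3 ?f4 ?f5.
Qed.

Definition ext3_map (h : V -> V) u : ext3 V :=
  ext3_cls [seq (h p.1.1, h p.1.2, h p.2) | p <- repr u].

Lemma ext3_map_wedge (h : V -> V) (x y z : V) : {morph h : a b / a + b} ->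
  ext3_map h (wedge3 x y z) = wedge3 (h x) (h y) (h z).
Proof.
move=> hD; apply/ext3_clsP => A f [f1 f2 f3 f4 f5].
rewrite /sum3 big_map /= big_seq1 /=.
have := ext3_clsK (wedge3 x y z); rewrite {2}/wedge3 => /ext3_clsP.
move=> /(_ A (fun a b c => f (h a) (h b) (h c))); rewrite /sum3 big_seq1 /=; apply.
by split=> *; rewrite ?hD ?f1 ?f2 ?f3 ?f4 ?f5.
Qed.

End Ext3Theory.

(** * Homology and the mapping class group *)

Section MappingClassGroup.
Context {R : realType} {F : surface R}.

(* Push-forward of a chart along the homeomorphism f with inverse f'. *)
Definition push_chart (f f' : F -> F) (c : chart R F) : chart R F :=
  Chart (f @` cdom c) (c \o f') (f \o cinv c).

(* A homeomorphism is an orientation preserving diffeomorphism iff it permutes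
   the charts of the maximal oriented atlas. *)
Record diffeo := Diffeo {
  dfun :> F -> F;
  dinv : F -> F;
  dfunK : cancel dfun dinv;
  dinvK : cancel dinv dfun;
  dfun_cont : continuous dfun;
  dinv_cont : continuous dinv;
  dfun_base : dfun (base F) = base F;
  dfun_atlas : forall c, atlas F c -> atlas F (push_chart dfun dinv c);
  dinv_atlas : forall c, atlas F c -> atlas F (push_chart dinv dfun c) }.

HB.instance Definition _ := gen_eqMixin diffeo.
HB.instance Definition _ := gen_choiceMixin diffeo.

Implicit Types f g : diffeo.

Lemma comp_cont f g : continuous (f \o g).
Proof. by move=> x; apply: continuous_comp; exact: dfun_cont. Qed.
Lemma compV_cont f g : continuous (dinv g \o dinv f).
Proof. by move=> x; apply: continuous_comp; exact: dinv_cont. Qed.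
Lemma comp_base f g : (f \o g) (base F) = base F.
Proof. by rewrite /= !dfun_base. Qed.
Lemma comp_atlas f g c : atlas F c ->
  atlas F (push_chart (f \o g) (dinv g \o dinv f) c).
Proof.
by move=> /(dfun_atlas g)/(dfun_atlas f); rewrite /push_chart /= image_comp.
Qed.
Lemma compV_atlas f g c : atlas F c ->
  atlas F (push_chart (dinv g \o dinv f) (f \o g) c).
Proof.
by move=> /(dinv_atlas f)/(dinv_atlas g); rewrite /push_chart /= image_comp.
Qed.

Definition diffeo_comp f g : diffeo :=
  Diffeo (can_comp (dfunK f) (dfunK g)) (can_comp (dinvK g) (dinvK f))
    (@comp_cont f g) (@compV_cont f g) (comp_base f g)
    (@comp_atlas f g) (@compV_atlas f g).

Definition smooth_isotopy f g : Prop :=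
  exists H : R -> diffeo, [/\ H 0 =1 f, H 1 =1 g,
    continuous (fun x : R * F => H x.1 x.2) &
    forall c c', atlas F c -> atlas F c' ->
      smooth_on [set x : R * (R * R) |
          (c @` cdom c) x.2 /\ cdom c' (H x.1 (cinv c x.2))]
        (fun x => c' (H x.1 (cinv c x.2)))].

(* Smooth isotopy is already an equivalence relation; passing to the generated
   one only spares the smoothing of concatenated isotopies. *)
Definition isotopicb f g : bool :=
  `[< clos_refl_sym_trans diffeo smooth_isotopy f g >].

Lemma isotopicb_equiv : equiv_class_of isotopicb.
Proof.
split=> [f|f g|g f h].
- by apply/asboolP; exact: rst_refl.
- by apply/asboolP/asboolP; exact: rst_sym.
- by move=> /asboolP fg /asboolP gh; apply/asboolP; exact: rst_trans gh.
Qed.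
Canonical isotopicb_canonical := EquivRelPack isotopicb_equiv.

Definition mcg := {eq_quot isotopicb_canonical}.

HB.instance Definition _ := Choice.on mcg.
HB.instance Definition _ := EqQuotient.on mcg.

Definition mcg_mul (phi psi : mcg) : mcg :=
  \pi_mcg (diffeo_comp (repr phi) (repr psi)).

Lemma map_loop_cont f (l : loop F) : continuous (f \o l).
Proof.
by move=> t; apply: continuous_comp; [exact: loop_cont|exact: dfun_cont].
Qed.
Lemma map_loop_le0 f (l : loop F) t : t <= 0 -> (f \o l) t = base F.
Proof. by move=> t0; rewrite /= loop_le0 // dfun_base. Qed.
Lemma map_loop_ge1 f (l : loop F) t : 1 <= t -> (f \o l) t = base F.
Proof. by move=> t1; rewrite /= loop_ge1 // dfun_base. Qed.
Definition map_loop f (l : loop F) : loop F :=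
  Loop (@map_loop_cont f l) (@map_loop_le0 f l) (@map_loop_ge1 f l).

Definition H1 := ab (pi1 F).
HB.instance Definition _ := GRing.Zmodule.on H1.

Definition hcls (l : loop F) : H1 := abcls (cls l).

Definition pi1_act (phi : mcg) (x : pi1 F) : pi1 F :=
  cls (map_loop (repr phi) (repr x)).
Definition H1_act (phi : mcg) (u : H1) : H1 := abcls (pi1_act phi (repr u)).
Definition ext3_act (phi : mcg) : ext3 H1 -> ext3 H1 := ext3_map (H1_act phi).

Definition torelli (phi : mcg) : Prop := forall u, H1_act phi u = u.

Definition has_genus (g : nat) : Prop :=
  exists2 f : 'rV[int]_(2 * g) -> H1, bijective f & {morph f : x y / x + y}.

(* The arc p starts as the straight segment of angle a in the chart c. *)
Definition ray (c : chart R F) (p : R -> F) (a e : R) : Prop :=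
  forall s, 0 <= s <= e ->
    cdom c (p s) /\ c (p s) = c (p 0) + (s * cos a, s * sin a).

Definition simple_loop (x : loop F) : Prop :=
  forall s t, 0 < s < 1 -> 0 <= t <= 1 -> x s = x t -> s = t.

(* The algebraic intersection pairing, pinned down on pairs of simple loops
   that meet at the base point only: it is 1 if the outgoing and incoming ends
   come in the counterclockwise order x-out, y-out, x-in, y-in (so that the
   tangent vectors of x and y form a positive basis), -1 if the order is x-out,
   y-in, x-in, y-out, and 0 if the ends do not alternate. *)
Definition is_intersection_pairing (w : H1 -> H1 -> int) : Prop :=
  [/\ forall u u' v, w (u + u') v = w u v + w u' v,
      forall u v v', w u (v + v') = w u v + w u v',
      forall u, w u u = 0 &
      forall x y : loop F, simple_loop x -> simple_loop y ->
        (forall s t, 0 < s < 1 -> 0 < t < 1 -> x s <> y t) ->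
      forall (c : chart R F) (e xo xi yo yi : R), atlas F c -> 0 < e ->
        ray c x xo e -> ray c (rev_loop x) xi e ->
        ray c y yo e -> ray c (rev_loop y) yi e ->
        xo < xi < xo + 2 * pi -> xo < yo < xo + 2 * pi ->
        xo < yi < xo + 2 * pi ->
        w (hcls x) (hcls y) = (yo < xi)%R%:Z - (yi < xi)%R%:Z].

(** * The Johnson homomorphism *)

(* The image of x /\ y /\ z under
     Lambda^3 H -> H (x) Lambda^2 H = Hom(H, Lambda^2 H) -> Hom(H, Gamma_1/Gamma_2),
   evaluated at c; here H = H^* by u |-> w u, and a /\ b |-> [a, b]. *)
Definition contraction (w : H1 -> H1 -> int) (c : pi1 F)
    (p : pi1 F * pi1 F * pi1 F) : pi1 F :=
  let: (x, y, z) := p in let h u := w (abcls u) (abcls c) in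
  (zexpg (bracket y z) (h x) * zexpg (bracket z x) (h y) *
   zexpg (bracket x y) (h z))%g.

(* tau_1(phi) = t : modulo Gamma_2, phi(c) c^-1 is the value at c of the
   homomorphism H -> Gamma_1/Gamma_2 given by t. *)
Definition is_johnson (w : H1 -> H1 -> int) (phi : mcg) (t : ext3 H1) : Prop :=
  exists2 s : seq (pi1 F * pi1 F * pi1 F),
    t = \sum_(p <- s) wedge3 (abcls p.1.1 : H1) (abcls p.1.2) (abcls p.2) &
    forall c : pi1 F, lcs 2
      (pi1_act phi c * c^-1 * (\prod_(p <- s) contraction w c p)^-1)%g.

End MappingClassGroup.
Arguments diffeo {R} F.
Arguments mcg {R} F.
Arguments H1 {R} F.
Arguments has_genus {R} F g.

(** * Trivalent fat graph spines *)

(* A trivalent fat graph with one boundary cycle. A dart is an oriented edge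
   pointing towards a vertex, op reverses the orientation, and rot d is the next
   dart pointing towards the same vertex, in the counterclockwise order. *)
Record fatgraph := Fatgraph {
  dart :> finType;
  op : dart -> dart;
  rot : dart -> dart;
  opK : involutive op;
  op_neq : forall d, op d != d;
  rot3 : forall d, rot (rot (rot d)) = d;
  rot_neq : forall d, rot d != d;
  dart_inh : dart;
  boundary_cycle : forall d d',
    exists n, iter n (fun x => op (rot (rot x))) d = d' }.
Arguments op {f} _ : rename.
Arguments rot {f} _ : rename.

Definition boundary (G : fatgraph) (d : G) : G := op (rot (rot d)).

Section Spines.
Context {R : realType} {F : surface R}.

(* An embedded trivalent spine of F - {*}, together with its dual arcs, which
   are determined by the graph up to isotopy. The dual arc of d crosses d from
   left to right, and the dual arcs of the darts pointing towards a vertex run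
   counterclockwise around it, whence the relation spine_rel and the
   counterclockwise order of the arcs at the base point. *)
Record spine := Spine {
  graph :> fatgraph;
  edge : graph -> R -> F;
  arc : graph -> loop F;
  (* the embedded graph *)
  edge_cont : forall d, continuous (edge d);
  edge_op : forall d t, edge (op d) t = edge d (1 - t);
  edge_head : forall d, edge (rot d) 1 = edge d 1;
  edge_inj : forall d d' s t, 0 < s < 1 -> 0 <= t <= 1 ->
    edge d s = edge d' t -> d' = d /\ t = s \/ d' = op d /\ t = 1 - s;
  vertex_inj : forall d d', edge d 1 = edge d' 1 ->
    [\/ d' = d, d' = rot d | d' = rot (rot d)];
  edge_base : forall d t, 0 <= t <= 1 -> edge d t <> base F;
  edge_ccw : forall d, exists (c : chart R F) (a : graph -> R) (e : R),
    [/\ atlas F c, 0 < e,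
        a d < a (rot d) < a (rot (rot d)), a (rot (rot d)) < a d + 2 * pi &
        forall i, i \in [:: d; rot d; rot (rot d)] ->
          ray c (fun s => edge i (1 - s)) (a i) e];
  (* F - {*} deformation retracts onto the graph *)
  spine_retract : let G := [set y | exists d t, 0 <= t <= 1 /\ y = edge d t] in
    exists K : R * F -> F,
    [/\ {within `[0, 1] `*` ~` [set base F], continuous K},
        forall x, x <> base F -> K (0, x) = x /\ G (K (1, x)),
        forall s x, 0 <= s <= 1 -> x <> base F -> K (s, x) <> base F &
        forall s x, 0 <= s <= 1 -> G x -> K (s, x) = x];
  (* the dual arcs *)
  arc_op : forall d t, arc (op d) t = arc d (1 - t);
  arc_inj : forall d d' s t, 0 < s < 1 -> 0 <= t <= 1 ->
    arc d s = arc d' t -> d' = d /\ t = s \/ d' = op d /\ t = 1 - s;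
  arc_edge : forall d d' s t, 0 <= s <= 1 -> 0 <= t <= 1 ->
    arc d s = edge d' t -> [/\ d' = d \/ d' = op d, s = 2^-1 & t = 2^-1];
  arc_cross : forall d, exists (c : chart R F) (p : R * R) (e : R),
    [/\ atlas F c, 0 < e & forall s, - e <= s <= e ->
      [/\ cdom c (arc d (2^-1 + s)), cdom c (edge d (2^-1 + s)),
          c (arc d (2^-1 + s)) = p + (s, 0) &
          c (edge d (2^-1 + s)) = p + (0, s)]];
  arc_ccw : exists (c : chart R F) (a : graph -> R) (e : R) (d0 : graph),
    [/\ atlas F c, 0 < e, forall d, ray c (arc d) (a d) e,
        forall i j, (i < j < #|graph|)%N ->
          a (iter i (@boundary graph) d0) < a (iter j (@boundary graph) d0) &
        forall d, a d < a d0 + 2 * pi];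
  (* the marking: the presentation of pi1 F dual to the spine; it follows from
     the above by the Seifert-van Kampen theorem *)
  spine_rel : forall d,
    (cls (arc d) * cls (arc (rot d)) * cls (arc (rot (rot d))) = 1)%g;
  spine_gen : forall x : pi1 F, generated [set cls (arc d) | d in [set: graph]] x;
  spine_univ : forall (K : groupType) (f : graph -> K),
    (forall d, f (op d) = (f d)^-1)%g ->
    (forall d, f d * f (rot d) * f (rot (rot d)) = 1)%g ->
    exists2 h : pi1 F -> K, {morph h : x y / (x * y)%g} &
      forall d, h (cls (arc d)) = f d }.

(* The homology class of an oriented edge. *)
Definition edge_class (S : spine) (d : S) : H1 F := hcls (arc d).

Definition reparam (u v : R -> F) : Prop :=
  exists r : R -> R, [/\ continuous r, r 0 = 0, r 1 = 1,
    {in `[0, 1] &, {mono r : s t / s <= t}} &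
    forall t, 0 <= t <= 1 -> u t = v (r t)].

Definition carries (h : F -> F) (S S' : spine) : Prop :=
  exists f : S -> S', [/\ bijective f,
    forall d, f (op d) = op (f d), forall d, f (rot d) = rot (f d),
    forall d, reparam (h \o edge d) (edge (f d)) &
    forall d, reparam (h \o arc d) (arc (f d))].

Definition isotopic (S S' : spine) : Prop :=
  exists H : R -> F -> F, [/\ H 0 =1 id,
    continuous (fun x : R * F => H x.1 x.2),
    forall t, bijective (H t), forall t, H t (base F) = base F &
    carries (H 1) S S'].

(** * Whitehead moves, the cocycle j and chains of 1-cells *)

Definition leg_a (G : fatgraph) (e : G) : G := rot e.
Definition leg_b (G : fatgraph) (e : G) : G := rot (rot e).
Definition leg_c (G : fatgraph) (e : G) : G := rot (op e).
Definition leg_d (G : fatgraph) (e : G) : G := rot (rot (op e)).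

Definition distinct_ends (G : fatgraph) (e : G) : bool :=
  op e \notin [:: e; rot e; rot (rot e)].

(* Around the two ends of e the cyclic orders are (e, a, b) and (op e, c, d), so
   that the legs come in the order a, b, c, d once e is collapsed. In the other
   expansion the new edge, again called e, has the orders (e, b, c) and
   (op e, d, a) around its ends. *)
Definition flip_rot (G : fatgraph) (e : G) (x : G) : G :=
  if x == e then leg_b e else if x == leg_b e then leg_c e else
  if x == leg_c e then e else if x == op e then leg_d e else
  if x == leg_d e then leg_a e else if x == leg_a e then op e else rot x.

(* Collapsing an edge and expanding the resulting vertex removes, respectively
   adds, one dual arc and keeps the other ones. *)
Definition whitehead (S : spine) (e : S) (S' : spine) : Prop :=
  exists f : S -> S', [/\ bijective f,
    forall x, f (op x) = op (f x), forall x, rot (f x) = f (flip_rot e x) &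
    forall x, x != e -> x != op e -> reparam (arc x) (arc (f x))].

Record cell1 := Cell1 {
  source : spine;
  moved : source;
  moved_ends : distinct_ends moved;
  target : spine;
  moved_target : whitehead moved target }.

Definition j (c : cell1) : ext3 (H1 F) :=
  let e := moved c in
  wedge3 (edge_class (leg_a e)) (edge_class (leg_b e)) (edge_class (leg_c e)).

Fixpoint chain (v : spine) (s : seq cell1) (w : spine) : Prop :=
  if s is c :: s' then isotopic v (source c) /\ chain (target c) s' w
  else isotopic v w.

Definition chain_to_image (v : spine) (phi : mcg F) (s : seq cell1) : Prop :=
  exists2 w : spine, carries (repr phi) v w & chain v s w.

End Spines.
Arguments spine {R} F.
Arguments cell1 {R} F.

(* Main.v *)
(* For an alternating form b on H and a trivalent spine S, let area_b(d) be
   the sum of b over the corners of the triangulation dual to S that lie to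
   the left of the dual arc of d. If b kills the fundamental class of F, then
   area_b is, up to the factor -6, the second order term of an expansion of
   pi_1: it extends from the arcs to a map theta on pi_1 with theta(xy) =
   theta(x) + theta(y) - 3 b(x, y). A Whitehead move changes theta(x) by the
   contraction of a /\ b /\ c = j with x, so theta measures the sum of j along
   any chain, while theta takes the value -6 b(y, z) on [y, z], which is the
   factor 6 in front of the Johnson homomorphism. The contractions modulo the
   fundamental class separate the points of Lambda^3 H. *)

From HB Require Import structures.
From mathcomp Require Import all_boot all_order all_algebra.
From mathcomp Require Import all_classical all_reals all_analysis.
From mathcomp Require Import zify ring.
Require Import Defs.

Set Implicit Arguments.
Unset Strict Implicit.
Unset Printing Implicit Defensive.

Import Order.TTheory GRing.Theory Num.Theory.
Import numFieldNormedType.Exports.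
Local Open Scope classical_set_scope.
Local Open Scope ring_scope.

(** The rule for [theta] says that pairing it with the class in H gives a homomorphism from pi_1 to
    a Heisenberg group. This homomorphism is attached to a spine and not to a path of moves, and it
    is unique because the arcs generate pi_1. A chain is thus compared through its two ends alone,
    and both independence of the chain and the crossed rule follow by cancelling values of [theta].
    The obstacle is that a dual arc need not separate F: its left side makes sense only as a
    function on the sectors at the base point, up to an additive constant. Areas ignore this
    constant exactly when b kills the fundamental class, and this restricts the forms that can be
    used. The 3 in the rule counts the corners of a triangle, which all have the same weight, and a
    commutator doubles it to 6. The 6 of [pairing_dual] has another origin: three corners per
    triangle, times 2 because b on two sides of a triangle is twice its area. It can be cancelled
    since every test form takes integer values, and the freeness of H makes integer forms
    sufficient. *)

(** * Loops up to homotopy and the action of mapping classes on pi_1 *)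

Section Loops.
Context {R : realType} {F : surface R}.
Implicit Types (l : loop F) (f : diffeo F) (phi psi : mcg F).

Lemma loop_ext l l' : l =1 l' -> l = l'.
Proof.
case: l l' => [u cu u0 u1] [v cv v0 v1] /= /funext uv; subst v.
by congr Loop; exact: Prop_irrelevance.
Qed.

Lemma cls_reparam l l' : reparam l l' -> cls l = cls l'.
Proof.
case=> r [cr r0 r1 _ lE]; apply: cls_eq.
(* [r] is controlled on [0, 1] only; [clamp] makes it constant outside, where the loop rests at the
   base point. *)
apply: (@homotopic_comp _ _ l' _ _ (fun t => r (clamp t)) id) => //.
- by move=> t; exact: (@continuous_comp _ _ _ _ r t (@clamp_cont _ _) (@cr _)).
- by move=> t; exact: cvg_id.
- by move=> t t0; left; rewrite /clamp min_r ?max_l ?r0 ?(le_trans t0) ?ler01.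
- by move=> t t1; right; rewrite /clamp min_l ?max_r ?r1 ?ler01.
- move=> t; have [t0|t0] := leP t 0.
    by rewrite /clamp min_r ?max_l ?r0 ?(le_trans t0) ?ler01 // !loop_le0.
  have [t1|t1] := leP 1 t.
    by rewrite /clamp min_l ?max_r ?r1 ?ler01 // !loop_ge1.
  by rewrite /clamp min_r ?max_r ?(ltW t0) ?(ltW t1) // lE // !ltW.
Qed.

Lemma map_homotopic f l l' :
  homotopic l l' -> homotopic (map_loop f l) (map_loop f l').
Proof.
case=> H [cH H0 H1 Hb]; exists (f \o H); split.
- by move=> x; apply: continuous_comp; [exact: cH|exact: dfun_cont].
- by move=> t /=; rewrite H0.
- by move=> t /=; rewrite H1.
- by move=> s t t01 /=; rewrite Hb // dfun_base.
Qed.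

Lemma pi1_act_cls phi l : pi1_act phi (cls l) = cls (map_loop (repr phi) l).
Proof. by apply/cls_eq/map_homotopic; exact: repr_cls. Qed.

Lemma pi1_actM phi : {morph pi1_act phi : x y / (x * y)%g}.
Proof.
move=> x y; rewrite -(clsK x) -(clsK y) -[(_ * _)%g]cls_cat !pi1_act_cls.
rewrite -[RHS]cls_cat; congr cls.
by apply: loop_ext => t; rewrite /= /cat_fun; case: ifP.
Qed.

Lemma pi1_act1 phi : pi1_act phi 1%g = 1%g.
Proof. by apply: (mulgI (pi1_act phi 1%g)); rewrite -pi1_actM !mulg1. Qed.

Lemma pi1_actV phi : {morph pi1_act phi : x / x^-1%g}.
Proof. by move=> x; apply: (mulgI (pi1_act phi x)); rewrite -pi1_actM !mulgV pi1_act1. Qed.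

Lemma isotopy_loop (H : R -> F -> F) l l0 l1 :
  continuous (fun x : R * F => H x.1 x.2) ->
  (forall t, H t (base F) = base F) ->
  l0 =1 H 0 \o l -> l1 =1 H 1 \o l -> cls l0 = cls l1.
Proof.
move=> cH Hb l0E l1E; apply: cls_eq; exists (fun x => H x.1 (l x.2)); split.
- move=> x; apply: (@continuous_comp _ _ _
    (fun x : R * R => (x.1, l x.2)) (fun x => H x.1 x.2) x _ (@cH _)).
  apply: pair_cont => y; first exact: cvg_fst.
  by apply: continuous_comp; [exact: cvg_snd|exact: loop_cont].
- by move=> t; rewrite l0E.
- by move=> t; rewrite l1E.
- by move=> s t [t0|t1]; rewrite /= ?(loop_le0 _ t0) ?(loop_ge1 _ t1) Hb.
Qed.

Lemma cls_map_isotopic f f' l :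
  isotopicb f f' -> cls (map_loop f l) = cls (map_loop f' l).
Proof.
move=> /asboolP; elim=> {f f'} [f f'|//|f f' _ -> //|f f' f'' _ -> _ -> //].
case=> H [H0 H1 cH _].
by apply: (isotopy_loop (H := fun t => H t) (l := l) cH
  (fun t => dfun_base (H t))) => t /=; rewrite ?H0 ?H1.
Qed.

Lemma pi1_act_mul phi psi x :
  pi1_act (mcg_mul phi psi) x = pi1_act phi (pi1_act psi x).
Proof.
rewrite -(clsK x) !pi1_act_cls.
rewrite (@cls_map_isotopic _ (diffeo_comp (repr phi) (repr psi))).
  by congr cls; exact: loop_ext.
by rewrite -eqmodE; apply/eqP; rewrite reprK.
Qed.

End Loops.

(** * Additive maps, alternating forms and the exterior cube *)

Section RawAdditive.
Context (V A : zmodType) (h : V -> A) (hD : {morph h : x y / x + y}).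

Lemma morphD0 : h 0 = 0.
Proof. by apply: (addrI (h 0)); rewrite -hD !addr0. Qed.

Lemma morphDN : {morph h : x / - x}.
Proof. by move=> x; apply: (addrI (h x)); rewrite -hD !subrr morphD0. Qed.

Lemma morphD_sum (I : Type) (r : seq I) (E : I -> V) :
  h (\sum_(i <- r) E i) = \sum_(i <- r) h (E i).
Proof. by apply: big_morph; [exact: hD|exact: morphD0]. Qed.

Lemma morphD_mulrz x n : h (x *~ n) = h x *~ n.
Proof.
have hn k : h (x *+ k) = h x *+ k.
  by elim: k => [|k IHk]; rewrite ?mulr0n ?morphD0 // !mulrS hD IHk.
by case: n => k; rewrite ?NegzE ?mulrNz ?morphDN -!pmulrn hn.
Qed.
End RawAdditive.

Section Alternation.
Context (V : zmodType).
Implicit Types (T : V -> V -> V -> int) (t : ext3 V).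

Definition trilinear T : Prop :=
  [/\ forall y z, {morph (fun x => T x y z) : x x' / x + x'},
      forall x z, {morph (fun y => T x y z) : y y' / y + y'} &
      forall x y, {morph (fun z => T x y z) : z z' / z + z'}].

Definition altern T (a b c : V) : int :=
  T a b c + T b c a + T c a b - T b a c - T a c b - T c b a.

Lemma altern_alternating T : trilinear T -> alternating3 (altern T).
Proof.
case=> /= T1 T2 T3; rewrite /altern.
by split=> *; rewrite ?T1 ?T2 ?T3; ring.
Qed.

Section Alternating.
Context (A : zmodType) (f : V -> V -> V -> A) (fA : alternating3 f).

Lemma alternating_swap12 x y z : f y x z = - f x y z.
Proof.
case: fA => f1 f2 _ f4 _; apply/eqP; rewrite -addr_eq0.
by have := f4 (x + y) z; rewrite f1 !f2 !f4 add0r addr0 addrC => ->.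
Qed.

Lemma alternating_swap23 x y z : f x z y = - f x y z.
Proof.
case: fA => _ f2 f3 _ f5; apply/eqP; rewrite -addr_eq0.
by have := f5 x (y + z); rewrite f2 !f3 !f5 add0r addr0 addrC => ->.
Qed.

Lemma alternating_cycle x y z : f y z x = f x y z.
Proof. by rewrite alternating_swap23 alternating_swap12 opprK. Qed.

Definition ext3_lift t : A := sum3 f (repr t).

Lemma ext3_lift_cls s : ext3_lift (ext3_cls s) = sum3 f s.
Proof.
by rewrite /ext3_lift; move: A f fA; apply/ext3_clsP; rewrite ext3_clsK.
Qed.

Lemma ext3_lift_wedge x y z : ext3_lift (wedge3 x y z) = f x y z.
Proof. by rewrite ext3_lift_cls /sum3 big_seq1. Qed.

Lemma ext3_liftD : {morph ext3_lift : t t' / t + t'}.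
Proof. by move=> t t'; rewrite [LHS]ext3_lift_cls sum3_cat. Qed.

End Alternating.

End Alternation.

Section FreeModules.

(** Triples with distinct entries fall into six classes according to the order of their entries.
    Permuting the indices brings each class to i < j < k, where the six terms cancel. *)
Lemma sum_ordered_triples (A : zmodType) n (F : 'I_n -> 'I_n -> 'I_n -> A) :
  (forall i k, F i i k = 0) -> (forall i k, F i k k = 0) ->
  (forall i k, F i k i = 0) ->
  (forall i j k, F i j k + F j k i + F k i j + F j i k + F i k j + F k j i = 0) ->
  \sum_i \sum_j \sum_k F i j k = 0.
Proof.
move=> F12 F23 F13 F0.
pose G (H : 'I_n -> 'I_n -> 'I_n -> A) := \sum_i \sum_j \sum_k H i j k.
have G12 H : G H = G (fun i j k => H j i k) by rewrite /G exchange_big.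
have G23 H : G H = G (fun i j k => H i k j).
  by apply: eq_bigr => i _; rewrite exchange_big.
have GD H H' : G (fun i j k => H i j k + H' i j k) = G H + G H'.
  rewrite /G -big_split; apply: eq_bigr => i _ /=.
  by rewrite -big_split; apply: eq_bigr => k _ /=; rewrite -big_split.
have eqG H H' : (forall i j k, H i j k = H' i j k) -> G H = G H'.
  by move=> HH'; do 3!apply: eq_bigr => ? _.
pose C (i j k : 'I_n) (a : A) : A := if (i < j < k)%N then a else 0.
pose H1 i j k := C i j k (F i j k); pose H2 i j k := C j k i (F i j k).
pose H3 i j k := C k i j (F i j k); pose H4 i j k := C j i k (F i j k).
pose H5 i j k := C i k j (F i j k); pose H6 i j k := C k j i (F i j k).
have -> : \sum_i \sum_j \sum_k F i j k =
    G H1 + (G H2 + (G H3 + (G H4 + (G H5 + G H6)))).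
  rewrite -!GD; apply: eqG => i j k; rewrite /H1 /H2 /H3 /H4 /H5 /H6 /C.
  have [->|ij] := eqVneq i j; first by rewrite F12 !if_same !addr0.
  have [->|jk] := eqVneq j k; first by rewrite F23 !if_same !addr0.
  have [->|ik] := eqVneq i k; first by rewrite F13 !if_same !addr0.
  have [lij|lij] := ltnP i j; have [ljk|ljk] := ltnP j k;
    have [lik|lik] := ltnP i k; rewrite /= ?andbF ?andbT ?addr0 ?add0r;
    move: ij jk ik; rewrite -!val_eqE /= => ij jk ik;
    do ?case: ifP => ?; rewrite ?addr0 ?add0r //; exfalso; lia.
rewrite (G12 H2) (G23 (fun i j k => H2 j i k)) (G23 H3) (G12 (fun i j k => H3 i k j)).
rewrite (G12 H4) (G23 H5) (G12 H6) (G23 (fun i j k => H6 j i k)).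
rewrite (G12 (fun i j k => H6 k i j)) -!GD /G; apply: big1 => i _; apply: big1 => j _; apply: big1 => k _.
rewrite /H1 /H2 /H3 /H4 /H5 /H6 /C; case: ifP => _; last by rewrite !addr0.
by rewrite -(F0 i j k) !addrA (addrAC _ (F k i j)).
Qed.

(** Equality in [ext3] is tested by maps into all abelian groups, torsion included. In coordinates,
    the coefficients of such a map at t are alternated products of coordinate functions, and these
    are integer alternating forms. *)
Lemma ext3_separated (V : zmodType) n (e : 'I_n -> V) (x : 'I_n -> V -> int)
    (t : ext3 V) :
  (forall i, {morph x i : u v / u + v}) ->
  (forall v, v = \sum_i e i *~ x i v) ->
  (forall f : V -> V -> V -> int, alternating3 f -> ext3_lift f t = 0) -> t = 0.
Proof.
move=> xD xE t0; rewrite -(ext3_clsK t); apply/(ext3_clsP _ [::]) => A f fA.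
have [f1 f2 f3 f4 f5] := fA; rewrite {2}/sum3 big_nil.
pose T i j k := \sum_(p <- repr t) x i p.1.1 * x j p.1.2 * x k p.2.
have -> : sum3 f (repr t) = \sum_i \sum_j \sum_k f (e i) (e j) (e k) *~ T i j k.
  transitivity (\sum_(p <- repr t) \sum_i \sum_j \sum_k
      f (e i) (e j) (e k) *~ (x i p.1.1 * x j p.1.2 * x k p.2)).
    apply: eq_bigr => -[[a b] c] _ /=.
    rewrite {1}(xE a) (@morphD_sum _ _ (fun u => f u b c) (fun u v => f1 u v b c)); apply: eq_bigr => i _.
    rewrite (@morphD_mulrz _ _ (fun u => f u b c) (fun u v => f1 u v b c)).
    rewrite {1}(xE b) (@morphD_sum _ _ (fun u => f (e i) u c) (fun u v => f2 (e i) u v c)) mulrz_suml; apply: eq_bigr => j _.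
    rewrite (@morphD_mulrz _ _ (fun u => f (e i) u c) (fun u v => f2 (e i) u v c)).
    rewrite {1}(xE c) (morphD_sum (f3 (e i) (e j))) !mulrz_suml; apply: eq_bigr => k _.
    rewrite (morphD_mulrz (f3 (e i) (e j))) -!mulrzA.
    by congr (_ *~ _); ring.
  rewrite exchange_big; apply: eq_bigr => i _; rewrite exchange_big.
  apply: eq_bigr => j _; rewrite exchange_big; apply: eq_bigr => k _.
  by rewrite -mulrz_sumr.
apply: sum_ordered_triples => [i k|i k|i k|i j k].
- by rewrite f4 mul0rz.
- by rewrite f5 mul0rz.
- by rewrite (alternating_swap23 fA) f4 oppr0 mul0rz.
(* The value of this form at t is the coefficient of [f (e i) (e j) (e k)] once the six orderings of
   i, j, k are collected. *)
have := t0 (altern (fun a b c => x i a * x j b * x k c)).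
have tri : trilinear (fun a b c => x i a * x j b * x k c).
  by split=> ? ? ? ?; rewrite xD; ring.
move=> /(_ (altern_alternating tri)).
rewrite /ext3_lift /sum3 /altern !(sumrB, big_split) /=.
have TE i' j' k' (p : V * V * V -> int) : p =1 (fun p => x i' p.1.1 * x j' p.1.2 * x k' p.2) ->
  \sum_(q <- repr t) p q = T i' j' k' by move=> pE; apply: eq_bigr => q _; rewrite pE.
rewrite (TE i j k) // (TE k i j); last by move=> p; ring.
rewrite (TE j k i); last by move=> p; ring.
rewrite (TE j i k); last by move=> p; ring.
rewrite (TE i k j); last by move=> p; ring.
rewrite (TE k j i); last by move=> p; ring.
move=> T0; rewrite (alternating_cycle fA (e i) (e j)).
rewrite -(alternating_cycle fA (e k) (e i)) (alternating_swap12 fA (e i) (e j)).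
rewrite (alternating_swap23 fA (e i) (e j)) -(alternating_cycle fA (e k) (e j)).
rewrite (alternating_swap12 fA (e i) (e j)).
rewrite !mulNrz -!mulrNz -!mulrzDr.
by rewrite (_ : _ + _ = 0) ?mulr0z // -T0; ring.
Qed.

End FreeModules.

(** * Fat graphs and the sectors at the base point *)

Section FatGraphs.
Context (G : fatgraph).
Implicit Types (d y z : G) (s : G -> int).

Lemma rot_inj : injective (@rot G).
Proof. by move=> x y xy; rewrite -(rot3 x) xy rot3. Qed.

Lemma op_inj : injective (@op G).
Proof. exact: inv_inj (@opK G). Qed.

Lemma boundary_inj : injective (@boundary G).
Proof. by move=> x y /op_inj/rot_inj/rot_inj. Qed.

Lemma boundary_rot y : boundary (rot y) = op y.
Proof. by rewrite /boundary rot3. Qed.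

Lemma fconnect_boundary d y : fconnect (@boundary G) d y.
Proof.
have [n <-] := boundary_cycle d y; exact: fconnect_iter.
Qed.

Lemma order_boundary d : fingraph.order (@boundary G) d = #|G|.
Proof.
by rewrite /fingraph.order; apply: eq_card => y; rewrite -[LHS]/(fconnect _ d y) fconnect_boundary.
Qed.

(* [s] increases by 1 at [d] and decreases by 1 at [op d] along the boundary
   cycle: up to a constant it is the indicator function of the sector of the
   base point that lies to the left of the dual arc of [d]. *)
Definition sector d s : Prop :=
  forall y, s (boundary y) - s y = (boundary y == d)%:Z - (boundary y == op d)%:Z.

Lemma sector_cst s :
  (forall y, s (boundary y) = s y) -> exists k, forall y, s y = k.
Proof.
move=> sB; exists (s (dart_inh G)) => y.
have [n <-] := boundary_cycle (dart_inh G) y.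
by elim: n => //= n IHn; rewrite -[RHS]IHn; exact: sB.
Qed.

Lemma sector_unique d s s' :
  sector d s -> sector d s' -> exists k, forall y, s y = s' y + k.
Proof.
move=> sd sd'; have [|k sk] := @sector_cst (fun y => s y - s' y).
  by move=> y; have := sd y; have := sd' y; lia.
by exists k => y; rewrite -(sk y); ring.
Qed.

Lemma sector_op d s : sector d s -> sector (op d) (fun y => - s y).
Proof. by move=> sd y; rewrite opK; have := sd y; lia. Qed.

Definition position d0 d : nat := findex (@boundary G) d0 d.

Lemma position_inj d0 : injective (position d0).
Proof.
move=> x y xy; rewrite -(iter_findex (fconnect_boundary d0 x)).
by rewrite -/(position d0 x) xy /position iter_findex // fconnect_boundary.
Qed.

Lemma position_lt d0 d : (position d0 d < #|G|)%N.
Proof. by rewrite -(order_boundary d0) findex_max // fconnect_boundary. Qed.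

Lemma iter_position d0 d : iter (position d0 d) (@boundary G) d0 = d.
Proof. by rewrite iter_findex // fconnect_boundary. Qed.

Lemma position_iter d0 i :
  (i < #|G|)%N -> position d0 (iter i (@boundary G) d0) = i.
Proof. by rewrite -(order_boundary d0); exact: findex_iter. Qed.

Lemma sector_position d0 d :
  sector d (fun y => (position d0 d <= position d0 y)%N%:Z
                   - (position d0 (op d) <= position d0 y)%N%:Z).
Proof.
move=> y; rewrite -!(inj_eq (@position_inj d0)).
set p := position d0 d; set q := position d0 (op d).
have pn : (p < #|G|)%N := position_lt d0 d.
have qn : (q < #|G|)%N := position_lt d0 (op d).
have yn := position_lt d0 y.
(* Just before the cut at [d0] both indicators are 1, so the return to position 0 creates no
   spurious jump. *)
have -> : position d0 (boundary y) =
    if (position d0 y).+1 == #|G| then 0%N else (position d0 y).+1.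
  rewrite -{1}(iter_position d0 y) -iterS; case: eqP => [->|yn'].
    by rewrite -(order_boundary d0) iter_order ?/position ?findex0 //; exact: boundary_inj.
  by rewrite position_iter //; lia.
by case: eqP => ?; lia.
Qed.

Lemma sum_rot (A : nmodType) (f : G -> A) : \sum_y f (rot y) = \sum_y f y.
Proof. by rewrite [RHS](reindex_inj rot_inj). Qed.

Lemma sum_boundary (A : nmodType) (f : G -> A) :
  \sum_y f (boundary y) = \sum_y f y.
Proof. by rewrite [RHS](reindex_inj boundary_inj). Qed.

Lemma sum_delta d (f : G -> int) : \sum_y (y == d)%:Z * f y = f d.
Proof.
rewrite (bigD1 d) //= eqxx mul1r big1 ?addr0 // => y /negbTE ->.
by rewrite mul0r.
Qed.

Section Weights.
Context (f : G -> int) (f_op : forall y, f (op y) = - f y)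
  (f_vertex : forall y, f y + f (rot y) + f (rot (rot y)) = 0).

Lemma weight_boundary y : f (boundary y) = f y + f (rot y).
Proof. by rewrite /boundary f_op; have := f_vertex y; lia. Qed.

(** Summation by parts along the boundary cycle: the jumps of [s] at [d] and [op d] contribute [f d]
    and [- f (op d)], which are equal; hence the 2. *)
Lemma sector_sum_rot d s : sector d s -> \sum_y s y * f (rot y) = - 2 * f d.
Proof.
move=> sd.
have : \sum_y s (boundary y) * f (boundary y) = \sum_y s y * f y.
  exact: (sum_boundary (fun y => s y * f y)).
have -> : \sum_y s (boundary y) * f (boundary y) =
   \sum_y s y * f y + \sum_y s y * f (rot y) +
   \sum_y ((boundary y == d)%:Z * f (boundary y)
          - (boundary y == op d)%:Z * f (boundary y)).
  rewrite -!big_split; apply: eq_bigr => y _ /=; rewrite -mulrBl -sd.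
  by rewrite weight_boundary; ring.
rewrite sumrB (sum_boundary (fun y => (y == d)%:Z * f y)).
rewrite (sum_boundary (fun y => (y == op d)%:Z * f y)) !sum_delta f_op.
by lia.
Qed.

End Weights.
End FatGraphs.

(** * The intersection pairing read off from sectors *)

Section Pairing.
Context {R : realType} {F : surface R}.
Implicit Types (S : spine F).

Lemma abclsD (x y : pi1 F) : abcls (x * y)%g = abcls x + abcls y :> H1 F.
Proof. exact: abclsM. Qed.

Lemma abclsN (x : pi1 F) : abcls x^-1%g = - abcls x :> H1 F.
Proof. exact: abclsV. Qed.

Lemma abcls0 : abcls 1%g = 0 :> H1 F. Proof. by []. Qed.

Lemma cls_arc_op S (d : S) : cls (arc (op d)) = (cls (arc d))^-1%g.
Proof.
rewrite -[RHS]cls_rev; congr cls; apply: loop_ext => t; exact: arc_op.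
Qed.

Lemma edge_class_op S (d : S) : edge_class (op d) = - edge_class d.
Proof. by rewrite /edge_class /hcls cls_arc_op abclsN. Qed.

Lemma edge_class_vertex S (d : S) :
  edge_class d + edge_class (rot d) + edge_class (rot (rot d)) = 0.
Proof. by rewrite -abcls0 -(spine_rel d) !abclsD. Qed.

Lemma edge_class_ext S (A : zmodType) (g g' : H1 F -> A) :
  {morph g : x y / x + y} -> {morph g' : x y / x + y} ->
  (forall d : S, g (edge_class d) = g' (edge_class d)) -> g =1 g'.
Proof.
move=> gD gD' gE u; rewrite -(abclsK u).
elim: (spine_gen S (repr u)) => [x [d _ <-]|||].
- exact: gE.
- by rewrite abcls0 !morphD0.
- by move=> x y _ IHx _ IHy; rewrite abclsD gD gD' IHx IHy.
- by move=> x _ IHx; rewrite abclsN !morphDN // IHx.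
Qed.

Lemma simple_arc S (d : S) : simple_loop (arc d).
Proof.
move=> s t s01 t01 /(arc_inj s01 t01) [[_ ->]//|[dE]].
by have := op_neq d; rewrite -dE eqxx.
Qed.

Lemma ray2pi (c : chart R F) p a e : ray c p a e -> ray c p (a + 2 * pi) e.
Proof.
move=> h s se; have [cs ->] := h s se; split=> //.
by rewrite mulr_natl cosD2pi sinD2pi.
Qed.

Lemma ray_eq (c : chart R F) p p' a e : p =1 p' -> ray c p a e -> ray c p' a e.
Proof. by move=> /funext <-. Qed.

Context (w : H1 F -> H1 F -> int) (w_pairing : is_intersection_pairing w).

Lemma pairing_opp u v : w v u = - w u v.
Proof.
case: w_pairing => w1 w2 w0 _; apply/eqP; rewrite -addr_eq0.
by have := w0 (u + v); rewrite w1 !w2 !w0 add0r addr0 addrC => ->.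
Qed.

(** [s y] is the sector just after the start of the arc of [y]; as [boundary (rot y)] is [op y],
    [s (rot y)] is the sector just before its end. With this choice of sides the formula also covers
    [y = d] and [y = op d], where it gives 0. *)
Lemma pairing_arc S (d y : S) s : sector d s ->
  w (edge_class d) (edge_class y) = s y - s (rot y).
Proof.
have [w1 w2 w0 wE] := w_pairing.
have wN u v : w u (- v) = - w u v by rewrite (morphDN (w2 u)).
move=> sd; have [c [a [e [d0 [ac e0 ra a_lt a_max]]]]] := arc_ccw S.
have [k sE] := sector_unique sd (sector_position d0 d).
rewrite !sE opprD addrACA subrr addr0.
have := sector_position d0 d; set s' := (X in sector d X) => s'P.
rewrite -[RHS]/(s' y - s' (rot y)).
have aE x z : (a x < a z) = (position d0 x < position d0 z)%N.
  have lt x' z' : (position d0 x' < position d0 z')%N -> a x' < a z'.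
    move=> xz; rewrite -(iter_position d0 x') -(iter_position d0 z').
    by apply: a_lt; rewrite xz position_lt.
  have [/lt -> //|/lt zx|/position_inj ->] := ltngtP; last by rewrite ltxx.
  by apply/negbTE; rewrite -leNgt ltW.
have pn x z : x != z -> position d0 x != position d0 z.
  by rewrite (inj_eq (@position_inj _ d0)).
have dop := pn _ _ (op_neq d).
have := s'P (rot y); rewrite boundary_rot (inj_eq (@op_inj S)).
have [->|yd] := eqVneq y d.
  rewrite /edge_class w0 (negbTE (op_neq d)) /s'.
  lia.
have [->|yd'] := eqVneq y (op d).
  rewrite edge_class_op wN w0 opK eqxx /s'.
  lia.
have ydo : (op y == d) = false.
  by apply/negbTE/eqP => yE; move: yd'; rewrite -yE opK eqxx.
rewrite ydo subr0 => s'rot.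
(* Angles lifted to the full turn that starts at [a d], as the description of the pairing
   requires. *)
pose N x : R := if a d < a x then a x else a x + 2 * pi.
have a_min x : a d0 <= a x by rewrite leNgt aE [X in (_ < X)%N]findex0.
have a_2pi x z : a x < a z + 2 * pi by apply: lt_le_trans (a_max x) _; rewrite lerD2r.
have N_in x : x != d -> a d < N x < a d + 2 * pi.
  move=> /pn xd; rewrite /N; case: ifPn => [dx|]; first by rewrite dx a_2pi.
  by rewrite aE -leqNgt => dx; rewrite a_2pi ltrD2r aE ltn_neqAle xd dx.
have rN x : ray c (arc x) (N x) e.
  by rewrite /N; case: ifP => _; [exact: ra|exact/ray2pi/ra].
have rrN x : ray c (rev_loop (arc x)) (N (op x)) e.
  by apply: ray_eq (rN (op x)) => t; rewrite arc_op.
(* The last term is the free constant of [s'], whose values are 0 and 1 if [d] precedes [op d] in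
   the cut order and -1 and 0 otherwise. It cancels in the difference of two such bits. *)
have N_lt x : x != d -> x != op d ->
    (N x < N (op d))%R%:Z = s' x + (position d0 (op d) < position d0 d)%N%:Z.
  move=> /pn xd /pn xo; rewrite /N /s' !aE.
  case: ifPn => dx; case: ifPn => dd; rewrite ?ltrD2r ?aE.
  - lia.
  - rewrite a_2pi; lia.
  - rewrite ltNge ltW ?a_2pi //; lia.
  - lia.
have -> : s' (rot y) = s' (op y) by move: s'rot; lia.
have opyd : op y != op d by rewrite (inj_eq (@op_inj S)).
rewrite /edge_class (wE _ _ (@simple_arc S d) (@simple_arc S y) _ c e (a d)
   (N (op d)) (N y) (N (op y))) ?N_in ?op_neq ?ydo //.
  rewrite !N_lt ?ydo //; lia.
move=> u v u01 /andP[v0 v1] uv.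
have v01 : 0 <= v <= 1 by rewrite !ltW.
by case: (arc_inj u01 v01 uv) => -[yE _]; [move: yd|move: yd']; rewrite yE eqxx.
Qed.

End Pairing.

(** * Alternating forms and their Heisenberg groups *)

Definition alternating2 (V : zmodType) (b : V -> V -> int) : Prop :=
  [/\ forall v, {morph (fun u => b u v) : u u' / u + u'},
      forall u, {morph b u : v v' / v + v'} & forall u, b u u = 0].

Lemma alternating2_swap (V : zmodType) (b : V -> V -> int) u v :
  alternating2 b -> b v u = - b u v.
Proof.
case=> b1 b2 b0; apply/eqP; rewrite -addr_eq0.
by have := b0 (u + v); rewrite b1 !b2 !b0 add0r addr0 addrC => ->.
Qed.

Section Heisenberg.
Context (V : zmodType) (b : V -> V -> int) (b_alt : alternating2 b).

(** The proof argument only marks the type, so that a group structure depending on [b] can be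
    attached to it. *)
Definition heisenberg of alternating2 b : Type := (V * int)%type.
Local Notation K := (heisenberg b_alt).
HB.instance Definition _ := Choice.copy K (V * int)%type.

Definition heis_mul (p q : K) : K := (p.1 + q.1, p.2 + q.2 - 3 * b p.1 q.1).
Definition heis_inv (p : K) : K := (- p.1, - p.2).

Lemma heis_mulA : associative heis_mul.
Proof.
have [b1 b2 _] := b_alt; move=> p q r; congr pair; rewrite /= ?addrA //.
by rewrite b1 b2; ring.
Qed.

Lemma heis_mul1 : left_id ((0, 0) : K) heis_mul.
Proof.
have [b1 _ _] := b_alt; move=> [u m]; congr pair; rewrite /= ?add0r //.
by rewrite (@morphD0 _ _ (b^~ u) (b1 u)); ring.
Qed.

Lemma heis_mulr1 : right_id ((0, 0) : K) heis_mul.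
Proof.
have [_ b2 _] := b_alt; move=> [u m]; congr pair; rewrite /= ?addr0 //.
by rewrite (morphD0 (b2 u)); ring.
Qed.

Lemma heis_mulV : left_inverse ((0, 0) : K) heis_inv heis_mul.
Proof.
have [b1 _ b0] := b_alt; move=> [u m]; congr pair; rewrite /= ?addNr //.
by rewrite (@morphDN _ _ (b^~ u) (b1 u)) b0; ring.
Qed.

Lemma heis_mulrV : right_inverse ((0, 0) : K) heis_inv heis_mul.
Proof.
have [_ b2 b0] := b_alt; move=> [u m]; congr pair; rewrite /= ?addrN //.
by rewrite (morphDN (b2 u)) b0; ring.
Qed.

HB.instance Definition _ := isGroup.Build K
  heis_mulA heis_mul1 heis_mulr1 heis_mulV heis_mulrV.
End Heisenberg.

(** * The area and the expansion defined by a spine *)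

Section Area.
Context {R : realType} {F : surface R} (b : H1 F -> H1 F -> int).
Context (b_alt : alternating2 b).
Implicit Types S : spine F.

(** The dart [y] stands for the corner at the start of its arc in the dual triangle with sides [y],
    [rot y], [rot (rot y)]. By [area_weight_rot] the three corners of a triangle have equal
    weights. *)
Definition area S (s : S -> int) : int :=
  \sum_y s y * b (edge_class y) (edge_class (rot y)).

Definition balanced S : Prop := area (fun _ : S => 1) = 0.

Lemma area_weight_rot S (y : S) :
  b (edge_class (rot y)) (edge_class (rot (rot y))) =
  b (edge_class y) (edge_class (rot y)).
Proof.
have [b1 b2 b0] := b_alt.
have -> : edge_class (rot (rot y)) = - (edge_class y + edge_class (rot y)).
  by apply/esym/eqP; rewrite -subr_eq0 -opprD oppr_eq0 edge_class_vertex.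
rewrite (morphDN (b2 _)) b2 b0 addr0 (alternating2_swap _ _ b_alt) opprK //.
Qed.

Lemma areaD S (s s' : S -> int) : area (fun y => s y + s' y) = area s + area s'.
Proof. by rewrite /area -big_split; apply: eq_bigr => y _; rewrite mulrDl. Qed.

Lemma areaZ S (k : int) (s : S -> int) : area (fun y => k * s y) = k * area s.
Proof. by rewrite /area mulr_sumr; apply: eq_bigr => y _; rewrite mulrA. Qed.

Lemma area_shift S (s s' : S -> int) k : balanced S ->
  (forall y, s y = s' y + k) -> area s = area s'.
Proof.
move=> S0 sE; rewrite (_ : s = fun y => s' y + k * 1).
  by rewrite areaD (areaZ k (fun=> 1)) S0 mulr0 addr0.
by apply/funext => y; rewrite sE mulr1.
Qed.

Lemma area_sector S (d : S) (s s' : S -> int) : balanced S ->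
  sector d s -> sector d s' -> area s = area s'.
Proof.
by move=> S0 sd s'd; have [k] := sector_unique sd s'd; exact: area_shift.
Qed.

Lemma area_op S (d : S) (s s' : S -> int) : balanced S ->
  sector d s -> sector (op d) s' -> area s' = - area s.
Proof.
move=> S0 /sector_op sd s'd; rewrite (area_sector S0 s'd sd).
by rewrite /area -sumrN; apply: eq_bigr => y _; rewrite mulNr.
Qed.

(** The three arcs bound a dual triangle: up to a constant, their sectors add up to the indicator of
    its three corners. This is the source of the 3 in [heis_mul]. *)
Lemma area_vertex S (d : S) (s1 s2 s3 : S -> int) : balanced S ->
  sector d s1 -> sector (rot d) s2 -> sector (rot (rot d)) s3 ->
  area s1 + area s2 + area s3 = 3 * b (edge_class d) (edge_class (rot d)).
Proof.
move=> S0 sd1 sd2 sd3.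
pose t y : int := (y == d)%:Z + (y == rot d)%:Z + (y == rot (rot d))%:Z.
have Bop (y z : S) : (boundary y == op z) = (y == rot z).
  by rewrite -boundary_rot (inj_eq (@boundary_inj S)).
have [k sE] : exists k, forall y, s1 y + s2 y + s3 y - t y = k.
  apply: sector_cst => y; have := sd1 y; have := sd2 y; have := sd3 y.
  by rewrite !Bop rot3 /t; lia.
rewrite -!areaD (@area_shift S _ t k) //; last by move=> y; rewrite -(sE y); ring.
rewrite /t !areaD /area !sum_delta !area_weight_rot; ring.
Qed.

(** The first clause makes x |-> ([abcls x], [theta x]) a homomorphism to the Heisenberg group, so
    that the presentation of pi_1 by arcs governs existence and uniqueness. *)
Definition expansion S (theta : pi1 F -> int) : Prop :=
  (forall x y : pi1 F, theta (x * y)%g =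
     theta x + theta y - 3 * b (abcls x) (abcls y)) /\
  forall (d : S) s, sector d s -> theta (cls (arc d)) = area s.

Section Quasimorphism.
Context (theta : pi1 F -> int) (thetaM : forall x y : pi1 F,
  theta (x * y)%g = theta x + theta y - 3 * b (abcls x) (abcls y)).

Lemma expansion1 : theta 1%g = 0.
Proof.
by case: b_alt => _ _ b0; have := thetaM 1%g 1%g; rewrite mulg1 b0; lia.
Qed.

Lemma expansionV x : theta x^-1%g = - theta x.
Proof.
case: b_alt => b1 b2 b0; have := thetaM x x^-1%g.
by rewrite mulgV expansion1 abclsN (morphDN (b2 _)) b0; lia.
Qed.

(** [x, y] is xy times the inverse of yx. These have the same class, so only -3 b(x, y) + 3 b(y, x)
    survives. *)
Lemma expansion_bracket x y :
  theta (bracket x y) = - 6 * b (abcls x) (abcls y).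
Proof.
rewrite /bracket -mulgA -invgM thetaM expansionV !thetaM.
rewrite abclsN !abclsD; case: (b_alt) => b1 b2 b0.
rewrite (morphDN (b2 _)) (addrC (abcls y)) b0 (alternating2_swap (abcls x) (abcls y)) //.
ring.
Qed.

Lemma expansion_op S (d : S) s s' : balanced S -> sector d s -> sector (op d) s' ->
  theta (cls (arc d)) = area s -> theta (cls (arc (op d))) = area s'.
Proof. by move=> S0 sd s'd sE; rewrite (area_op S0 sd) // -sE cls_arc_op expansionV. Qed.

Lemma expansion_vertex S (d : S) s1 s2 s3 : balanced S ->
  sector d s1 -> sector (rot d) s2 -> sector (rot (rot d)) s3 ->
  theta (cls (arc d)) = area s1 -> theta (cls (arc (rot d))) = area s2 ->
  theta (cls (arc (rot (rot d)))) = area s3.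
Proof.
move=> S0 sd1 sd2 sd3 E1 E2; have := area_vertex S0 sd1 sd2 sd3.
rewrite -E1 -E2; have : theta (cls (arc d) * cls (arc (rot d)) *
   cls (arc (rot (rot d))))%g = 0 by rewrite spine_rel expansion1.
have := congr1 (b (edge_class d + edge_class (rot d))) (edge_class_vertex d).
case: (b_alt) => b1 b2 b0.
rewrite b2 b0 (morphD0 (b2 _)) add0r !thetaM abclsD => ->.
by rewrite /edge_class /hcls; lia.
Qed.

End Quasimorphism.

Lemma expansion_unique S theta theta' :
  expansion S theta -> expansion S theta' -> theta =1 theta'.
Proof.
move=> [tM tE] [tM' tE'] x; elim: (spine_gen S x) => [y [d _ <-]|||].
- by rewrite (tE _ _ (sector_position d d)) (tE' _ _ (sector_position d d)).
- by rewrite !expansion1.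
- by move=> y z _ IHy _ IHz; rewrite tM tM' IHy IHz.
- by move=> y _ IHy; rewrite !expansionV // IHy.
Qed.

Lemma expansion_exists S : balanced S -> exists theta, expansion S theta.
Proof.
move=> S0; have [b1 b2 b0] := b_alt.
pose s (d : S) : S -> int := fun y => (position d d <= position d y)%N%:Z
                   - (position d (op d) <= position d y)%N%:Z.
have sP d : sector d (s d) := sector_position d d.
pose f (d : S) : heisenberg b_alt := (edge_class d, area (s d)).
have [||h hM hE] := spine_univ (K := heisenberg b_alt) (f := f).
- by move=> d; rewrite /f edge_class_op (area_op S0 (sP d)).
- move=> d; congr pair; rewrite /= ?edge_class_vertex //.
  have := area_vertex S0 (sP d) (sP (rot d)) (sP (rot (rot d))).
  have := congr1 (b (edge_class d + edge_class (rot d))) (edge_class_vertex d).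
  by rewrite b2 b0 (morphD0 (b2 _)) add0r => ->; lia.
have h1M x y : (h (x * y)%g).1 = (h x).1 + (h y).1 by rewrite hM.
have h11 : (h 1%g).1 = 0 by apply: (addrI (h 1%g).1); rewrite -h1M mulg1 addr0.
have h1 x : (h x).1 = abcls x.
  elim: (spine_gen S x) => [_ [d _ <-]|||] //; first by rewrite hE.
    by move=> y z _ IHy _ IHz; rewrite h1M IHy IHz abclsD.
  by move=> y _ IHy; apply: (addrI (h y).1); rewrite -h1M mulgV h11 IHy abclsN subrr.
exists (fun x => (h x).2); split=> [x y|d s' sd]; first by rewrite hM /= !h1.
by rewrite hE /=; exact: area_sector (sP d) sd.
Qed.

End Area.

(** * Combinatorics of a Whitehead move *)

Lemma sum_supported (I : finType) (A : nmodType) (r : seq I) (f : I -> A) :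
  uniq r -> (forall i, i \notin r -> f i = 0) -> \sum_i f i = \sum_(i <- r) f i.
Proof.
by move=> ur f0; rewrite (bigID (mem r)) /= big_uniq // [X in _ + X]big1 ?addr0.
Qed.

Ltac split_conj := repeat match goal with
  | H : is_true (_ && _) |- _ => move/andP: H => [? ?]
  end.

Ltac neq_simpl := repeat match goal with
  | |- context [?x == ?x] => rewrite (eqxx x)
  | H : is_true (?x != ?y) |- context [?x == ?y] => rewrite (negbTE H)
  | H : is_true (?x != ?y) |- context [?y == ?x] =>
      rewrite (eq_sym y x) (negbTE H)
  end.

Section Flip.
Context (G : fatgraph) (e : G) (e_ends : distinct_ends e).

Definition legs : seq G :=
  [:: e; op e; leg_a e; leg_b e; leg_c e; leg_d e].

(** The two ends of [e] are different vertices with three darts each. Two legs may still be opposite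
    to each other, as the two orientations of one edge. *)
Lemma legs_uniq : uniq legs.
Proof.
move: e_ends; rewrite /distinct_ends /legs /leg_a /leg_b /leg_c /leg_d.
rewrite !inE !negb_or => /and3P[oe oa ob].
have rn (x : G) : (x == rot x) = false by rewrite eq_sym (negbTE (rot_neq x)).
have rrn (x : G) : (x == rot (rot x)) = false.
  by rewrite -{1}(rot3 x) !(inj_eq (@rot_inj G)) (negbTE (rot_neq x)).
have r12 (x y : G) : (x == rot y) = (rot (rot x) == y).
  by rewrite -{2}(rot3 y) !(inj_eq (@rot_inj G)).
have r21 (x y : G) : (x == rot (rot y)) = (rot x == y).
  by rewrite -(inj_eq (@rot_inj G)) rot3.
rewrite /= !inE !negb_or !(inj_eq (@rot_inj G)) !rn !rrn r12 r21.
by rewrite ![_ == op e]eq_sym oe oa ob.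
Qed.

Definition flip_boundary (x : G) : G := op (flip_rot e (flip_rot e x)).

Lemma flip_rotE :
  [/\ flip_rot e e = leg_b e, flip_rot e (leg_b e) = leg_c e,
      flip_rot e (leg_c e) = e, flip_rot e (op e) = leg_d e &
      flip_rot e (leg_d e) = leg_a e /\ flip_rot e (leg_a e) = op e].
Proof.
have := legs_uniq; rewrite /legs /= !inE !negb_or => h.
by split_conj; rewrite /flip_rot; do 2?split; neq_simpl.
Qed.

Lemma flip_rot_other x : x \notin legs -> flip_rot e x = rot x.
Proof.
rewrite /legs !inE !negb_or /flip_rot => /and5P[/negbTE-> /negbTE-> /negbTE->
  /negbTE-> /andP[/negbTE-> /negbTE->]] //.
Qed.

Lemma legs_rot x : (rot x \in legs) = (x \in legs).
Proof.
have rot_legs y : y \in legs -> rot y \in legs.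
  rewrite /legs !inE /leg_a /leg_b /leg_c /leg_d.
  by move=> /or4P[|||/or3P[]] /eqP ->; rewrite ?rot3 !eqxx ?orbT.
by apply/idP/idP => [/rot_legs/rot_legs|/rot_legs //]; rewrite rot3.
Qed.

Lemma flip_boundaryE :
  [/\ flip_boundary e = op (leg_c e), flip_boundary (leg_b e) = op e,
      flip_boundary (leg_c e) = op (leg_b e),
      flip_boundary (op e) = op (leg_a e) &
      flip_boundary (leg_d e) = e /\ flip_boundary (leg_a e) = op (leg_d e)].
Proof.
have [Ee Eb Ec Eo [Ed Ea]] := flip_rotE.
pose E := (Ee, Eb, Ec, Eo, Ed, Ea).
by rewrite /flip_boundary; split; rewrite !E ?opK //; split; rewrite !E ?opK.
Qed.

(** There is no jump at [e] or [op e], so their new values are forced by their predecessors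
    [leg_d e] and [leg_b e] on the new boundary cycle. *)
Lemma flip_sector x s : sector x s -> x != e -> x != op e ->
  let s' y := if y == e then s (leg_d e) else if y == op e then s (leg_b e) else s y in
  forall y, s' (flip_boundary y) - s' y =
    (flip_boundary y == x)%:Z - (flip_boundary y == op x)%:Z.
Proof.
move=> sx xe xo s' y.
have [Ee Eb Ec Eo [Ed Ea]] := flip_boundaryE.
have opn (z t : G) : z != op t -> op z != t.
  by move=> zt; rewrite -(opK t) (inj_eq (@op_inj G)).
have := legs_uniq; rewrite /legs /= !inE !negb_or => h.
have xo' : op x != e by apply: opn.
have xe' : op x != op e by rewrite (inj_eq (@op_inj G)).
have s'E z : z != e -> z != op e -> s' z = s z.
  by rewrite /s' => /negbTE -> /negbTE ->.
have s'op z : z != e -> z != op e -> s' (op z) = s (op z).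
  by move=> ze zo; apply: s'E; [exact: opn|rewrite (inj_eq (@op_inj G))].
have s'e : s' e = s (leg_d e) by rewrite /s' eqxx.
have s'o : s' (op e) = s (leg_b e) by rewrite /s' eqxx (negbTE (op_neq e)).
have Bc : boundary (leg_c e) = e by rewrite boundary_rot opK.
have Ba : boundary (leg_a e) = op e by rewrite boundary_rot.
have Bb : boundary (leg_b e) = op (leg_a e) by rewrite boundary_rot.
have Bd : boundary (leg_d e) = op (leg_c e) by rewrite boundary_rot.
have Be : boundary e = op (leg_b e) by [].
have Bo : boundary (op e) = op (leg_d e) by [].
move: (sx (leg_a e)) (sx (leg_b e)) (sx (leg_c e)) (sx (leg_d e)) (sx e) (sx (op e)).
rewrite Ba Bb Bc Bd Be Bo.
split_conj.
have [yl|yl] := boolP (y \in legs).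
  move: yl; rewrite /legs !inE.
  by move=> /or4P[|||/or3P[]] /eqP ->;
    rewrite ?Ee ?Eb ?Ec ?Ed ?Ea ?Eo ?s'e ?s'o ?s'op ?s'E //;
    neq_simpl; clear; lia.
move=> _ _ _ _ _ _; have -> : flip_boundary y = boundary y.
  by rewrite /flip_boundary (flip_rot_other yl) flip_rot_other ?legs_rot.
rewrite (s'E y) ?s'E ?sx //.
- by apply: contra yl => /eqP; rewrite -[X in _ = X]Bc => /boundary_inj ->;
    rewrite /legs !inE eqxx !orbT.
- by apply: contra yl => /eqP; rewrite -[X in _ = X]Ba => /boundary_inj ->;
    rewrite /legs !inE eqxx !orbT.
- by apply: contra yl => /eqP ->; rewrite /legs !inE eqxx.
- by apply: contra yl => /eqP ->; rewrite /legs !inE eqxx orbT.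
Qed.

End Flip.

(** * The effect of a Whitehead move on areas and expansions *)

Section Whitehead.
Context {R : realType} {F : surface R}.
Context (w : H1 F -> H1 F -> int) (w_pairing : is_intersection_pairing w).
Context (b : H1 F -> H1 F -> int) (b_alt : alternating2 b).

(** The interior product of u /\ v /\ z with w(-, x), followed by b. *)
Definition contract (x u v z : H1 F) : int :=
  w u x * b v z + w v x * b z u + w z x * b u v.

Lemma contract_alternating x : alternating3 (contract x).
Proof.
have [b1 b2 b0] := b_alt; have [w1 w2 w0 _] := w_pairing.
have bN u v : b v u = - b u v by exact: alternating2_swap.
split=> [u u' v z|u v v' z|u v z z'|u z|u v]; rewrite /contract ?w1 ?b1 ?b2 ?b0; try ring.
  by rewrite (bN u z); ring.
by rewrite (bN u v); ring.
Qed.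

Lemma contractD u v z : {morph (fun x => contract x u v z) : x x' / x + x'}.
Proof.
by have [_ w2 _ _] := w_pairing; move=> x x'; rewrite /contract !w2; ring.
Qed.

Section Move.
Context (S S' : spine F) (e : S) (e_ends : distinct_ends e).
Context (f : S -> S') (f_bij : bijective f) (f_op : forall x, f (op x) = op (f x))
  (f_rot : forall x, rot (f x) = f (flip_rot e x))
  (f_arc : forall x, x != e -> x != op e -> reparam (arc x) (arc (f x))).

Local Notation c := (@edge_class R F S).
Local Notation c' x := (edge_class (f x)).

Lemma move_class x : x != e -> x != op e -> c' x = c x.
Proof. by move=> xe xo; rewrite /edge_class /hcls (cls_reparam (f_arc xe xo)). Qed.

(** The move flips the diagonal of a quadrilateral with sides a, b, c, d, and only the six corners
    of its two triangles change. As the sector of [x] does not jump at the diagonal, they involve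
    [s] at the four legs only. The relation w(y, x) = [s (rot y) - s y] turns the difference into a
    contraction. *)
Lemma move_area x s s' : balanced b S' ->
  x != e -> x != op e -> sector x s -> sector (f x) s' ->
  area b s' = area b s + contract (c x) (c (leg_a e)) (c (leg_b e)) (c (leg_c e)).
Proof.
move=> S0' xe xo sx s'x; have [g fK gK] := f_bij.
have f_boundary y : f (flip_boundary e y) = boundary (f y).
  by rewrite /boundary !f_rot -f_op.
pose t y := if y == e then s (leg_d e) else if y == op e then s (leg_b e) else s y.
have tx : sector (f x) (t \o g).
  move=> z; rewrite -(gK z) -f_boundary /= !fK -f_op !(inj_eq (can_inj fK)).
  exact: flip_sector.
rewrite (area_sector S0' s'x tx) /area (reindex f) /=; last by exists g => ? _.
under eq_bigr => y _ do rewrite fK f_rot.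
apply/eqP; rewrite addrC -subr_eq; apply/eqP; rewrite -sumrB.
have legsN z : z \notin legs e -> z != e /\ z != op e.
  by rewrite /legs !inE !negb_or => /and3P[-> ->].
have := legs_uniq e_ends; rewrite /legs /= !inE !negb_or => legs_neq.
rewrite (sum_supported (legs_uniq e_ends)) => [|y yl]; last first.
  have [ye yo] := legsN _ yl; have [re ro] : rot y != e /\ rot y != op e.
    by apply: legsN; rewrite legs_rot.
  by rewrite (flip_rot_other yl) !move_class // /t (negbTE ye) (negbTE yo) subrr.
have W y : b (c' (flip_rot e y)) (c' (flip_rot e (flip_rot e y))) =
           b (c' y) (c' (flip_rot e y)).
  by rewrite -!f_rot (area_weight_rot b_alt).
have [Ee Eb Ec Eo [Ed Ea]] := flip_rotE e_ends.
have Wc := W (leg_b e); have We := W (leg_c e); have Wa := W (leg_d e).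
have Wo := W (leg_a e); rewrite !(Ee, Eb, Ec, Eo, Ed, Ea) in Wc We Wa Wo.
have Va : b (c (leg_a e)) (c (leg_b e)) = b (c e) (c (leg_a e)).
  exact: (area_weight_rot b_alt e).
have Vb : b (c (leg_b e)) (c (rot (leg_b e))) = b (c e) (c (leg_a e)).
  by rewrite -Va; exact: (area_weight_rot b_alt (leg_a e)).
have Vc : b (c (leg_c e)) (c (leg_d e)) = b (c (op e)) (c (leg_c e)).
  exact: (area_weight_rot b_alt (op e)).
have Vd : b (c (leg_d e)) (c (rot (leg_d e))) = b (c (op e)) (c (leg_c e)).
  by rewrite -Vc; exact: (area_weight_rot b_alt (leg_c e)).
rewrite /legs !big_cons big_nil Ee Eb Ec Eo Ed Ea addr0.
rewrite -[rot e]/(leg_a e) -[rot (op e)]/(leg_c e) -[rot (leg_a e)]/(leg_b e).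
rewrite -[rot (leg_c e)]/(leg_d e) Vb Vd Wo Wa We Wc -Va -Vc.
split_conj.
have -> : t e = s (leg_d e) by rewrite /t eqxx.
have -> : t (op e) = s (leg_b e) by rewrite /t eqxx (negbTE (op_neq e)).
rewrite !move_class /t; neq_simpl => //.
have opx z : (op z == op x) = (z == x) by rewrite (inj_eq (@op_inj S)).
have opxe z : (z == op x) = (op z == x) by rewrite -opx opK.
have se : s e = s (leg_c e).
  have := sx (leg_c e); rewrite boundary_rot opK opxe; neq_simpl; clear; lia.
have so : s (op e) = s (leg_a e).
  have := sx (leg_a e); rewrite boundary_rot opx; neq_simpl; clear; lia.
have D : c (leg_d e) = - (c (leg_a e) + c (leg_b e) + c (leg_c e)).
  have /eqP := edge_class_vertex (op e); rewrite edge_class_op addr_eq0 => /eqP.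
  have /eqP := edge_class_vertex e; rewrite -addrA addrC addr_eq0 => /eqP.
  rewrite -/(leg_a e) -/(leg_b e) -/(leg_c e) -/(leg_d e) => -> ->; rewrite ?opprK //.
have [b1 b2 b0] := b_alt.
have wE y : w (c y) (c x) = s (rot y) - s y.
  by rewrite (pairing_opp w_pairing) (pairing_arc w_pairing _ sx) opprB.
rewrite se so D /contract !wE.
rewrite (morphDN (b2 _)) !b2 b0 (@morphDN _ _ (b^~ _) (b1 _)) !b1 b0.
rewrite (alternating2_swap (c (leg_a e)) (c (leg_b e))) //.
rewrite (alternating2_swap (c (leg_b e)) (c (leg_c e))) //.
rewrite -[rot (leg_a e)]/(leg_b e) -[rot (leg_c e)]/(leg_d e).
rewrite (_ : rot (leg_b e) = e) ?rot3 // se; ring.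
Qed.

Lemma move_expansion theta : balanced b S -> balanced b S' -> expansion b S theta ->
  expansion b S' (fun z => theta z +
    contract (abcls z) (c (leg_a e)) (c (leg_b e)) (c (leg_c e))).
Proof.
move=> S0 S0' [thetaM thetaE]; set theta' := (X in expansion _ _ X).
have theta'M x y :
    theta' (x * y)%g = theta' x + theta' y - 3 * b (abcls x) (abcls y).
  by rewrite /theta' thetaM abclsD contractD; ring.
have [Ee Eb Ec Eo _] := flip_rotE e_ends; have [g fK gK] := f_bij.
split=> // d s' s'd; rewrite -(gK d) in s' s'd *; move: (g d) s'd => x {d} s'x.
have other y t : y != e -> y != op e -> sector (f y) t ->
    theta' (cls (arc (f y))) = area b t.
  move=> ye yo ty; rewrite (move_area S0' ye yo (sector_position y y) ty).
  rewrite -(thetaE _ _ (sector_position y y)).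
  by rewrite /theta' -(cls_reparam (f_arc ye yo)).
(* The new arc has no counterpart in [S]; its value is forced by the vertex relation with the arcs
   of legs b and c. *)
have fe t : sector (f e) t -> theta' (cls (arc (f e))) = area b t.
  have := legs_uniq e_ends; rewrite /legs /= !inE !negb_or => legs_neq te.
  have fb : rot (f (leg_b e)) = f (leg_c e) by rewrite f_rot Eb.
  have fc : rot (rot (f (leg_b e))) = f e by rewrite fb f_rot Ec.
  rewrite -fc in t te *.
  apply: (expansion_vertex b_alt theta'M S0' (sector_position (f e) (f (leg_b e)))
    (sector_position (f e) _) te); last rewrite fb.
    by apply: (other _ _ _ _ (sector_position (f e) _)); split_conj; neq_simpl.
  by apply: (other _ _ _ _ (sector_position (f e) _)); split_conj; neq_simpl.
have [xe|xe] := eqVneq x e; first by rewrite xe in s' s'x *; exact: fe.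
have [xo|xo] := eqVneq x (op e); last exact: other.
rewrite xo f_op in s' s'x *.
exact: (expansion_op b_alt theta'M S0' (sector_position (f e) (f e)) s'x (fe _ (sector_position _ _))).
Qed.

End Move.
End Whitehead.

(** * Transport along isotopies and mapping classes *)

Section Action.
Context {R : realType} {F : surface R}.
Implicit Types (S : spine F) (phi : mcg F).

Lemma pi1_act_lcs1 phi x : lcs 1 x -> lcs 1 (pi1_act phi x).
Proof.
elim=> {x} [_ [x [y [_ ->]]]||x y _ IHx _ IHy|x _ IHx].
- by rewrite /bracket !pi1_actM !pi1_actV; exact: bracket_lcs1.
- by rewrite pi1_act1; exact: gen_1.
- by rewrite pi1_actM; exact: gen_mul.
- by rewrite pi1_actV; exact: gen_inv.
Qed.

Lemma H1_act_abcls phi (x : pi1 F) : H1_act phi (abcls x) = abcls (pi1_act phi x).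
Proof.
apply: abcls_eq; rewrite -pi1_actV -pi1_actM; apply: pi1_act_lcs1.
exact: repr_abcls.
Qed.

Lemma H1_actD phi : {morph H1_act phi : u v / u + v}.
Proof.
move=> u v; rewrite -(abclsK u) -(abclsK v) -abclsD !H1_act_abcls.
by rewrite pi1_actM abclsD.
Qed.

Lemma H1_act_mul phi psi u :
  H1_act (mcg_mul phi psi) u = H1_act phi (H1_act psi u).
Proof. by rewrite -(abclsK u) !H1_act_abcls pi1_act_mul abclsK. Qed.

Lemma carries_act phi S S' : carries (repr phi) S S' ->
  exists f : S -> S', [/\ bijective f, forall d, f (op d) = op (f d),
    forall d, f (rot d) = rot (f d) &
    forall d, pi1_act phi (cls (arc d)) = cls (arc (f d))].
Proof.
case=> f [f_bij f_op f_rot _ f_arc]; exists f; split=> // d.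
by rewrite pi1_act_cls; exact: (@cls_reparam _ _ (map_loop (repr phi) (arc d)) (arc (f d)) (f_arc d)).
Qed.

Lemma isotopic_marking S S' : isotopic S S' ->
  exists f : S -> S', [/\ bijective f, forall d, f (op d) = op (f d),
    forall d, f (rot d) = rot (f d) & forall d, cls (arc d) = cls (arc (f d))].
Proof.
case=> H [H0 cH _ Hb [f [f_bij f_op f_rot _ f_arc]]]; exists f; split=> // d.
have cl : continuous (H 1 \o arc d).
  move=> t; apply: (@continuous_comp _ _ _ (fun t => (1 : R, arc d t))
    (fun x => H x.1 x.2) t _ (@cH _)).
  by apply: pair_cont => s; [exact: cvg_cst|exact: loop_cont].
have l0 t : t <= 0 -> (H 1 \o arc d) t = base F by move=> t0; rewrite /= loop_le0.
have l1 t : 1 <= t -> (H 1 \o arc d) t = base F by move=> t1; rewrite /= loop_ge1.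
rewrite -(@cls_reparam _ _ (Loop cl l0 l1) (arc (f d)) (f_arc d)).
by apply: (isotopy_loop (l := arc d) cH Hb) => // t; rewrite /= H0.
Qed.

Section Isomorphism.
Context (S S' : spine F) (f : S -> S') (f_bij : bijective f)
  (f_op : forall d, f (op d) = op (f d))
  (f_rot : forall d, f (rot d) = rot (f d)).

Lemma iso_sector d (s : S' -> int) : sector (f d) s <-> sector d (s \o f).
Proof.
have [g fK gK] := f_bij.
have fB y : boundary (f y) = f (boundary y) by rewrite /boundary f_op !f_rot.
split=> sd y.
  by have := sd (f y); rewrite /= fB -f_op !(inj_eq (can_inj fK)).
by have := sd (g y); rewrite /= -!(inj_eq (can_inj fK)) -fB f_op gK.
Qed.

End Isomorphism.

End Action.

Section Transport.
Context {R : realType} {F : surface R}.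
Implicit Types (S : spine F) (phi : mcg F) (b : H1 F -> H1 F -> int).

Lemma iso_area S S' (f : S -> S') b b' (s : S' -> int) :
  bijective f -> (forall d, f (rot d) = rot (f d)) ->
  (forall x y, b (edge_class x) (edge_class y) =
               b' (edge_class (f x)) (edge_class (f y))) ->
  area b' s = area b (s \o f).
Proof.
case=> g fK gK f_rot bb'; rewrite /area (reindex f) /=; last by exists g => ? _.
by apply: eq_bigr => y _; rewrite bb' f_rot.
Qed.

Lemma isotopic_expansion S S' b theta : isotopic S S' ->
  expansion b S theta -> expansion b S' theta.
Proof.
move=> /isotopic_marking [f [f_bij f_op f_rot f_cls]] [tM tE]; split=> // d s.
have [g _ gK] := f_bij; rewrite -(gK d) => sd.
have := sd; rewrite (iso_sector f_bij f_op f_rot) -f_cls => /tE ->.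
by apply/esym/iso_area => // x y; rewrite /edge_class /hcls -!f_cls.
Qed.

Definition pull phi b (u v : H1 F) : int := b (H1_act phi u) (H1_act phi v).

Lemma carries_expansion phi S S' b theta : carries (repr phi) S S' ->
  expansion b S' theta -> expansion (pull phi b) S (theta \o pi1_act phi).
Proof.
move=> /carries_act [f [f_bij f_op f_rot f_cls]] [tM tE].
split=> [x y|d s sd] /=; first by rewrite pi1_actM tM /pull !H1_act_abcls.
have [g fK gK] := f_bij; have sE : s = (s \o g) \o f by apply/funext => y /=; rewrite fK.
rewrite f_cls (tE _ (s \o g)); last by apply/(iso_sector f_bij f_op f_rot); rewrite -sE.
rewrite [in RHS]sE; apply: iso_area => // x y.
by rewrite /pull /edge_class /hcls !H1_act_abcls !f_cls.
Qed.

(** * Invariance of the pairing and forms that kill the fundamental class *)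

Context (w : H1 F -> H1 F -> int) (w_pairing : is_intersection_pairing w).

Lemma pairing_alternating2 : alternating2 w.
Proof. by case: w_pairing => w1 w2 w0 _; split=> [v u u'|u v v'|//]; rewrite ?w1 ?w2. Qed.

(** [pairing_arc] computes [w] from the fat graph alone, and [phi] induces an isomorphism of fat
    graphs from [S] to [S']. *)
Lemma pairing_act phi S S' u v : carries (repr phi) S S' ->
  w (H1_act phi u) (H1_act phi v) = w u v.
Proof.
move=> /carries_act [f [f_bij f_op f_rot f_cls]]; have [w1 w2 w0] := pairing_alternating2.
have act_class (x : S) : H1_act phi (edge_class x) = edge_class (f x).
  by rewrite /edge_class /hcls H1_act_abcls f_cls.
move: u; apply: (@edge_class_ext _ _ S) => [x y|x y|d]; rewrite ?H1_actD ?w1 //.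
move: v; apply: (@edge_class_ext _ _ S) => [x y|x y|y]; rewrite ?H1_actD ?w2 //.
have sd := sector_position (f d) (f d).
rewrite !act_class (pairing_arc w_pairing _ sd) -f_rot.
by have /(iso_sector f_bij f_op f_rot) sd' := sd; rewrite (pairing_arc w_pairing _ sd').
Qed.

(* The triangles dual to the vertices of the spine add up to the fundamental
   class of the surface, which is dual to the intersection form. *)
Lemma pairing_dual S (h : H1 F -> int) u : {morph h : x y / x + y} ->
  \sum_(y : S) (w (edge_class y) u * h (edge_class (rot y)) -
                w (edge_class (rot y)) u * h (edge_class y)) = 6 * h u.
Proof.
move=> hD; have [w1 w2 w0] := pairing_alternating2; move: u.
apply: (@edge_class_ext _ _ S) => [u v|u v|p]; first last.
- pose s : S -> int := fun y => (position p p <= position p y)%N%:Z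
                   - (position p (op p) <= position p y)%N%:Z.
  have sp : sector p s := sector_position p p.
  pose k (y : S) := h (edge_class y).
  have k_op y : k (op y) = - k y by rewrite /k edge_class_op morphDN.
  have k_vertex y : k y + k (rot y) + k (rot (rot y)) = 0.
    by rewrite /k -!hD edge_class_vertex morphD0.
  have wp y : w (edge_class y) (edge_class p) = s (rot y) - s y.
    by rewrite (pairing_opp w_pairing) (pairing_arc w_pairing _ sp) opprB.
  (* Let A, B, C be the sums of [s y] times [k] at [y], [rot y], [rot (rot y)]. The left side is A +
     C - 2B; since A + B + C = 0 and B = -2 [k p], this is 6 [k p]. *)
  transitivity (\sum_y (s (rot y) * k (rot y) - s (rot (rot y)) * k y)
     + \sum_y s (rot y) * k y - \sum_y s y * k (rot y)).
    by rewrite -big_split -sumrB; apply: eq_bigr => y _ /=; rewrite !wp /k; ring.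
  rewrite sumrB (sum_rot (fun y => s y * k y)).
  rewrite -(sum_rot (fun y => s (rot (rot y)) * k y)).
  under [X in _ - X + _ - _]eq_bigr => y _ do rewrite rot3.
  rewrite -(sum_rot (fun y => s (rot y) * k y)) -(sum_rot (fun y => s (rot (rot y)) * k (rot y))).
  under [X in _ + X - _]eq_bigr => y _ do rewrite rot3.
  have := sector_sum_rot k_op k_vertex sp.
  have : \sum_y s y * k y + \sum_y s y * k (rot y)
       + \sum_y s y * k (rot (rot y)) = 0.
    by rewrite -!big_split big1 // => y _ /=; rewrite -!mulrDr k_vertex mulr0.
  rewrite -/(k p); move: (\sum_y s y * k y) (\sum_y s y * k (rot y))
    (\sum_y s y * k (rot (rot y))) (k p); lia.
- by rewrite hD mulrDr.
- by rewrite -big_split; apply: eq_bigr => y _ /=; rewrite !w2; ring.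
Qed.

Definition minor (u v x y : H1 F) : int := w x u * w y v - w y u * w x v.

(* For fixed [u v u' v'] this form vanishes on the class dual to the
   intersection form; these forms replace the quotient of Lambda^2 H by that
   class. *)
Definition kappa (u v u' v' x y : H1 F) : int :=
  minor u v x y * w u' v' - w u v * minor u' v' x y.

Lemma minor_alternating2 u v : alternating2 (minor u v).
Proof.
by have [w1 w2 w0] := pairing_alternating2; split=> [y x x'|x y y'|x]; rewrite /minor ?w1; ring.
Qed.

Lemma kappa_alternating2 u v u' v' : alternating2 (kappa u v u' v').
Proof.
have [m1 m2 m0] := minor_alternating2 u v.
have [n1 n2 n0] := minor_alternating2 u' v'.
by split=> [y x x'|x y y'|x]; rewrite /kappa ?m1 ?m2 ?m0 ?n1 ?n2 ?n0; ring.
Qed.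

(** By [pairing_dual], [minor x y] has total weight 6 w(x, y); the two products in [kappa] then
    cancel. *)
Lemma kappa_balanced S u v u' v' : balanced (kappa u v u' v') S.
Proof.
have [w1 w2 w0] := pairing_alternating2.
have mE x y : \sum_(z : S) minor x y (edge_class z) (edge_class (rot z)) = 6 * w x y.
  by rewrite -(pairing_dual S _ (fun z z' => w1 y z z')); apply: eq_bigr.
rewrite /balanced /area; under eq_bigr => y _ do rewrite mul1r.
by rewrite sumrB -mulr_suml -mulr_sumr !mE; ring.
Qed.

Lemma pull_kappa phi S S' u v u' v' : carries (repr phi) S S' ->
  pull phi (kappa (H1_act phi u) (H1_act phi v) (H1_act phi u') (H1_act phi v'))
  = kappa u v u' v'.
Proof.
move=> ca; apply/funext => x; apply/funext => y.
by rewrite /pull /kappa /minor !(pairing_act _ _ ca).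
Qed.

End Transport.

(** * Contractions that separate the points of the exterior cube *)

Section Detection.
Context {R : realType} {F : surface R}.
Context (w : H1 F -> H1 F -> int) (w_pairing : is_intersection_pairing w).
Implicit Types (t : ext3 (H1 F)) (b : H1 F -> H1 F -> int).

Lemma chain_expansion b (v v' : spine F) s theta : alternating2 b ->
  (forall S, balanced b S) -> chain v s v' -> expansion b v theta ->
  expansion b v' (fun z => theta z +
    ext3_lift (contract w b (abcls z)) (\sum_(c <- s) j c)).
Proof.
move=> b_alt b0; elim: s v theta => [|c s IHs] v theta /=.
  move=> vv' vE; rewrite big_nil.
  rewrite (_ : (fun z => _) = theta); first exact: isotopic_expansion vE.
  by apply/funext => z; rewrite morphD0 ?addr0 //; exact/ext3_liftD/contract_alternating.
move=> [/isotopic_expansion vc /IHs cs] /vc cE.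
have [f [f_bij f_op f_rot f_arc]] := moved_target c.
have := cs _ (move_expansion w_pairing b_alt (moved_ends c) f_bij f_op f_rot f_arc
  (b0 _) (b0 _) cE).
congr (expansion b v'); apply/funext => z; rewrite big_cons -addrA; congr (_ + _).
have zA := contract_alternating w_pairing b_alt (abcls z).
by rewrite (ext3_liftD zA) (ext3_lift_wedge zA).
Qed.

Definition alternated (t : ext3 (H1 F)) (T : H1 F -> H1 F -> H1 F -> int) : int :=
  ext3_lift (altern T) t.

Lemma alternated_sum S t (T : H1 F -> H1 F -> H1 F -> int)
    (k k' : S -> int) (U U' : S -> H1 F -> H1 F -> H1 F -> int) (r : seq S) :
  (forall u v z, 6 * T u v z = \sum_(y <- r) (k y * U y u v z - k' y * U' y u v z)) ->
  6 * alternated t T =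
  \sum_(y <- r) (k y * alternated t (U y) - k' y * alternated t (U' y)).
Proof.
move=> TE; rewrite /alternated /ext3_lift /sum3 mulr_sumr.
transitivity (\sum_(p <- repr t) \sum_(y <- r)
  (k y * altern (U y) p.1.1 p.1.2 p.2 - k' y * altern (U' y) p.1.1 p.1.2 p.2)).
  apply: eq_bigr => p _; rewrite /altern !(mulrBr, mulrDr) !TE.
  by rewrite -!(sumrN, big_split) /=; apply: eq_bigr => y _; ring.
by rewrite exchange_big; apply: eq_bigr => y _; rewrite sumrB -!mulr_sumr.
Qed.

Lemma contract_minor x u v : contract w (minor w u v) x =
  altern (fun p q r => w p x * w q u * w r v).
Proof.
apply/funext => p; apply/funext => q; apply/funext => r.
by rewrite /contract /minor /altern; ring.
Qed.

(** [pairing_dual] writes 6 h as an integer combination of the functionals w(-, c y). Used in one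
    slot after another, it leads from products of three such functionals to all trilinear forms. *)
Lemma minor_detection (S : spine F) t (f : H1 F -> H1 F -> H1 F -> int) :
  (forall u v x, ext3_lift (contract w (minor w u v) x) t = 0) ->
  alternating3 f -> ext3_lift f t = 0.
Proof.
have [w1 w2 w0] := pairing_alternating2 w_pairing.
move=> t0 fA; pose c := @edge_class R F S.
have dual (h : H1 F -> int) u : {morph h : x y / x + y} ->
    6 * h u = \sum_(y : S) (h (c y) * w u (c (rot y)) - h (c (rot y)) * w u (c y)).
  move=> hD; rewrite -(pairing_dual w_pairing S u hD) -/c.
  by apply: eq_bigr => y _; rewrite !(pairing_opp w_pairing _ u) /c; ring.
have six0 (n : int) : 6 * n = 0 -> n = 0 by lia.
have Z1 x u (h : H1 F -> int) : {morph h : u v / u + v} ->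
    alternated t (fun p q r => w p x * w q u * h r) = 0.
  move=> hD; apply: six0; rewrite (@alternated_sum S t _ (h \o c) (h \o (c \o rot))
    (fun y p q r => w p x * w q u * w r (c (rot y)))
    (fun y p q r => w p x * w q u * w r (c y)) (index_enum _)).
    apply: big1 => y _.
    by rewrite /alternated -!contract_minor !t0 !mulr0 subrr.
  move=> p q r; rewrite mulrCA dual // mulr_sumr; apply: eq_bigr => y _ /=; ring.
have Z2 x (h : H1 F -> H1 F -> int) : (forall v, {morph h^~ v : u u' / u + u'}) ->
    (forall u, {morph h u : v v' / v + v'}) ->
    alternated t (fun p q r => w p x * h q r) = 0.
  move=> h1 h2; apply: six0; rewrite (@alternated_sum S t _ (fun=> 1) (fun=> 1)
    (fun y p q r => w p x * w q (c (rot y)) * h (c y) r)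
    (fun y p q r => w p x * w q (c y) * h (c (rot y)) r) (index_enum _)).
    by apply: big1 => y _; rewrite !Z1 ?mulr0.
  move=> p q r; rewrite mulrCA (dual (h^~ r)) // mulr_sumr; apply: eq_bigr => y _ /=; ring.
have [f1 f2 f3 f4 f5] := fA.
have Z3 : alternated t f = 0.
  apply: six0; rewrite (@alternated_sum S t _ (fun=> 1) (fun=> 1)
    (fun y p q r => w p (c (rot y)) * f (c y) q r)
    (fun y p q r => w p (c y) * f (c (rot y)) q r) (index_enum _)).
    by apply: big1 => y _; rewrite !Z2 ?mulr0 // => *; rewrite ?f2 ?f3.
  move=> p q r; rewrite (dual (fun p => f p q r)) => [|x y]; last exact: f1.
  by apply: eq_bigr => y _ /=; ring.
(* [altern] sums over six permutations, so it multiplies the alternating form [f] by 6. *)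
apply: six0; rewrite -Z3 /alternated /ext3_lift /sum3 mulr_sumr.
apply: eq_bigr => -[[x y] z] _; rewrite /altern /=.
rewrite (alternating_cycle fA x y) -(alternating_cycle fA z x).
rewrite (alternating_swap12 fA x y) (alternating_swap23 fA x y).
rewrite -(alternating_cycle fA z y) (alternating_swap12 fA x y).
ring.
Qed.

(** The hypothesis reads L(u, v, x) w(u', v') = w(u, v) L(u', v', x), with L the contraction by
    [minor]. For u' = x the right side vanishes, being the alternation of a product with w(-, x) in
    two slots. So L(u, v, x) = 0 unless w(x, -) = 0, and in that case contracting with x already
    gives 0. *)
Lemma kappa_detection g (S : spine F) t : has_genus F g ->
  (forall u v u' v' x, ext3_lift (contract w (kappa w u v u' v') x) t = 0) -> t = 0.
Proof.
case=> f [h hK fK] fD t0.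
have [w1 w2 w0] := pairing_alternating2 w_pairing.
pose L u v x := ext3_lift (contract w (minor w u v) x) t.
have LE u v u' v' x : L u v x * w u' v' = w u v * L u' v' x.
  apply/eqP; rewrite -subr_eq0 -(t0 u v u' v' x); apply/eqP.
  rewrite /L /ext3_lift /sum3 mulr_suml mulr_sumr -sumrB; apply: eq_bigr => p _.
  by rewrite /contract /kappa; ring.
have Lx u x : L x u x = 0.
  rewrite /L /ext3_lift /sum3 big1 // => p _.
  by rewrite /contract /minor; ring.
have L0 u v x : L u v x = 0.
  have [[v' xv']|x0] := pselect (exists v', w x v' != 0).
    by have /eqP := LE u v x v' x; rewrite Lx mulr0 mulf_eq0 (negbTE xv') orbF => /eqP.
  have wx y : w y x = 0.
    rewrite (pairing_opp w_pairing) ; apply/eqP; rewrite oppr_eq0.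
    by apply/negPn/negP => xy; apply: x0; exists y.
  rewrite /L /ext3_lift /sum3 big1 // => p _.
  by rewrite /contract !wx !mul0r !addr0.
have hD : {morph h : x y / x + y}.
  by move=> x y; apply: (can_inj hK); rewrite fD !fK.
apply: (@ext3_separated _ _ (fun i => f (delta_mx 0 i)) (fun i u => h u 0 i)).
- by move=> i u v; rewrite hD mxE.
- move=> u; rewrite -{1}(fK u) {1}(row_sum_delta (h u)) morphD_sum //.
  apply: eq_bigr => i _; rewrite -morphD_mulrz //; congr f.
  by rewrite -scaler_int intz.
- by move=> k kA; apply: (minor_detection S).
Qed.

End Detection.

(** * Expansions on the lower central series and the Johnson homomorphism *)

Section Torelli.
Context {R : realType} {F : surface R}.
Context (w : H1 F -> H1 F -> int) (w_pairing : is_intersection_pairing w).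
Implicit Types (phi : mcg F) (t : ext3 (H1 F)).

Lemma pi1_act_surj phi (S S' : spine F) : carries (repr phi) S S' ->
  forall y, exists x, pi1_act phi x = y.
Proof.
move=> /carries_act [f [[g fK gK] _ _ f_cls]] y.
elim: (spine_gen S' y) => [_ [d _ <-]||x z _ [x' <-] _ [z' <-]|x _ [x' <-]].
- by exists (cls (arc (g d))); rewrite f_cls gK.
- by exists 1%g; rewrite pi1_act1.
- by exists (x' * z')%g; rewrite pi1_actM.
- by exists x'^-1%g; rewrite pi1_actV.
Qed.

Lemma H1_act_surj phi (S S' : spine F) : carries (repr phi) S S' ->
  forall u, exists v, H1_act phi v = u.
Proof.
move=> /pi1_act_surj phi_surj u; have [x xE] := phi_surj (repr u).
by exists (abcls x); rewrite H1_act_abcls xE abclsK.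
Qed.

Lemma contract_act phi (S S' : spine F) u v u' v' x t : carries (repr phi) S S' ->
  ext3_lift (contract w (kappa w (H1_act phi u) (H1_act phi v) (H1_act phi u')
    (H1_act phi v')) (H1_act phi x)) (ext3_act phi t) =
  ext3_lift (contract w (kappa w u v u' v') x) t.
Proof.
move=> ca; rewrite ext3_lift_cls; last first.
  exact/contract_alternating/kappa_alternating2.
rewrite /sum3 big_map; apply: eq_bigr => p _ /=.
by rewrite /contract /kappa /minor !(pairing_act w_pairing _ _ ca).
Qed.

Section LowerCentral.
Context (b : H1 F -> H1 F -> int) (b_alt : alternating2 b).
Context (theta : pi1 F -> int) (thetaM : forall x y : pi1 F,
  theta (x * y)%g = theta x + theta y - 3 * b (abcls x) (abcls y)).

Let b0l u : b 0 u = 0.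
Proof. by case: b_alt => b1 _ _; exact: (@morphD0 _ _ (b^~ u) (b1 u)). Qed.

Lemma abcls_bracket (x y : pi1 F) : abcls (bracket x y) = 0 :> H1 F.
Proof.
by rewrite -abcls0; apply: abcls_eq; rewrite invg1 mulg1; exact: bracket_lcs1.
Qed.

(** Once the class in H is known to be 0, [theta] is additive; on a generator [x, y] with y in
    Gamma_1 it is -6 b(x, 0). *)
Lemma expansion_lcs2 x : lcs 2 x -> theta x = 0.
Proof.
suff h : lcs 2 x -> theta x = 0 /\ abcls x = 0 :> H1 F by move=> /h [].
elim=> {x} [_ [x [y [y1 ->]]]||x y _ [x0 x0'] _ [y0 y0']|x _ [x0 x0']].
- have y0 : abcls y = 0 :> H1 F.
    by rewrite -abcls0; apply: abcls_eq; rewrite invg1 mulg1.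
  rewrite abcls_bracket (expansion_bracket b_alt thetaM) y0.
  by case: b_alt => _ b2 _; rewrite (morphD0 (b2 _)) mulr0.
- by rewrite (expansion1 b_alt thetaM) abcls0.
- by rewrite thetaM abclsD x0 y0 x0' y0' b0l mulr0 !addr0.
- by rewrite (expansionV b_alt thetaM) abclsN x0 x0' !oppr0.
Qed.

Lemma expansion_zexpg x n : abcls x = 0 :> H1 F ->
  theta (zexpg x n) = n * theta x /\ abcls (zexpg x n) = 0 :> H1 F.
Proof.
move=> x0; have pow k : theta (x ^+ k)%g = k%:Z * theta x /\ abcls (x ^+ k)%g = 0 :> H1 F.
  elim: k => [|k [IHt IHa]]; first by rewrite expg0 (expansion1 b_alt thetaM) abcls0 mul0r.
  by rewrite expgS thetaM abclsD x0 IHt IHa b0l add0r intS; split=> //; ring.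
case: n => k /=; first exact: pow.
have [tk ak] := pow k.+1.
by rewrite (expansionV b_alt thetaM) abclsN tk ak oppr0 NegzE mulNr.
Qed.

Lemma expansion_contraction c p :
  theta (contraction w c p) =
    - 6 * contract w b (abcls c) (abcls p.1.1) (abcls p.1.2) (abcls p.2)
  /\ abcls (contraction w c p) = 0 :> H1 F.
Proof.
case: p => [[x y] z] /=; rewrite !thetaM !abclsD.
have [t1 a1] := expansion_zexpg (w (abcls x) (abcls c)) (abcls_bracket y z).
have [t2 a2] := expansion_zexpg (w (abcls y) (abcls c)) (abcls_bracket z x).
have [t3 a3] := expansion_zexpg (w (abcls z) (abcls c)) (abcls_bracket x y).
rewrite t1 t2 t3 a1 a2 a3 !b0l !(expansion_bracket b_alt thetaM) !addr0 b0l.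
by split=> //; rewrite /contract; ring.
Qed.

Lemma expansion_prod_contraction c s :
  theta (\prod_(p <- s) contraction w c p)%g =
    - 6 * \sum_(p <- s) contract w b (abcls c) (abcls p.1.1) (abcls p.1.2) (abcls p.2)
  /\ abcls (\prod_(p <- s) contraction w c p)%g = 0 :> H1 F.
Proof.
elim: s => [|p s [IHt IHa]].
  by rewrite !big_nil (expansion1 b_alt thetaM) abcls0 mulr0.
have [tp ap] := expansion_contraction c p.
by rewrite !big_cons thetaM abclsD tp ap IHt IHa b0l; split; [ring|rewrite addr0].
Qed.

(** [theta] does not see Gamma_2, so [pi1_act phi c] times the inverse of c may be replaced by the
    product of contractions, in which each bracket contributes a factor -6. *)
Lemma expansion_johnson phi t c : torelli phi -> is_johnson w phi t ->
  theta (pi1_act phi c) = theta c - 6 * ext3_lift (contract w b (abcls c)) t.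
Proof.
move=> phiT [s -> /(_ c)/expansion_lcs2].
have [tP aP] := expansion_prod_contraction c s.
rewrite !thetaM !abclsN aP !(expansionV b_alt thetaM) tP -H1_act_abcls phiT.
have cA := contract_alternating w_pairing b_alt (abcls c).
rewrite (@morphD_sum _ _ _ (ext3_liftD cA)).
rewrite (eq_bigr _ (fun p _ => ext3_lift_wedge cA _ _ _)).
case: b_alt => _ b2 b0.
by rewrite oppr0 (morphD0 (b2 _)) (morphDN (b2 _)) b0; move: (\sum_(p <- s) _) => X; lia.
Qed.

End LowerCentral.

End Torelli.

Theorem theorem3p3 (R : realType) (F : surface R) (g : nat)
  (g_ge1 : (1 <= g)%N) (F_genus : has_genus F g)
  (w : H1 F -> H1 F -> int) (w_pairing : is_intersection_pairing w)
  (tau : mcg F -> ext3 (H1 F))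
  (tau_johnson : forall phi : mcg F, torelli phi -> is_johnson w phi (tau phi))
  (v0 : spine F) (jt : mcg F -> ext3 (H1 F))
  (jt_chain : forall phi : mcg F, exists2 s : seq (cell1 F),
    chain_to_image v0 phi s & jt phi = \sum_(c <- s) j c) :
  [/\ forall (phi : mcg F) (s : seq (cell1 F)),
        chain_to_image v0 phi s -> jt phi = \sum_(c <- s) j c,
      forall phi psi : mcg F,
        jt (mcg_mul phi psi) = jt phi + ext3_act phi (jt psi) &
      forall phi : mcg F, torelli phi -> jt phi = tau phi *+ 6].
Proof.
pose C u v u' v' x := ext3_lift (contract w (kappa w u v u' v') x).
have kA u v u' v' : alternating2 (kappa w u v u' v').
  exact: kappa_alternating2.
have CD u v u' v' x : {morph C u v u' v' x : t t' / t + t'}.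
  exact/ext3_liftD/contract_alternating.
have ex u v u' v' : exists theta, expansion (kappa w u v u' v') v0 theta.
  exact/expansion_exists/kappa_balanced.
have eqC t t' : (forall u v u' v' x, C u v u' v' x t = C u v u' v' x t') -> t = t'.
  move=> tt'; apply/eqP; rewrite -subr_eq0; apply/eqP.
  apply: (kappa_detection w_pairing v0 F_genus) => u v u' v' x.
  by rewrite -/(C u v u' v' x _) CD (morphDN (CD _ _ _ _ _)) tt' subrr.
(* The chain is seen by the expansions of [v0] alone: those of its end are
   pulled back by [phi]. *)
have key phi s u v u' v' theta theta' : chain_to_image v0 phi s ->
    expansion (kappa w (H1_act phi u) (H1_act phi v) (H1_act phi u')
      (H1_act phi v')) v0 theta ->
    expansion (kappa w u v u' v') v0 theta' ->
    forall x, theta' x = theta (pi1_act phi x) +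
      C (H1_act phi u) (H1_act phi v) (H1_act phi u') (H1_act phi v')
        (H1_act phi (abcls x)) (\sum_(c <- s) j c).
  move=> [v1 ca ch] tE tE' x.
  have := carries_expansion ca (chain_expansion w_pairing (kA _ _ _ _)
    (fun S => kappa_balanced w_pairing S _ _ _ _) ch tE).
  rewrite (pull_kappa w_pairing _ _ _ _ ca) => /(expansion_unique (kA _ _ _ _) tE').
  by move=> /(_ x); rewrite /= H1_act_abcls.
have surj (phi : mcg F) u : exists v, H1_act phi v = u.
  by have [s [v1 ca _] _] := jt_chain phi; exact: (H1_act_surj ca).
have jt_key phi u v u' v' theta theta' :
    expansion (kappa w (H1_act phi u) (H1_act phi v) (H1_act phi u')
      (H1_act phi v')) v0 theta ->
    expansion (kappa w u v u' v') v0 theta' ->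
    forall x, theta' x = theta (pi1_act phi x) +
      C (H1_act phi u) (H1_act phi v) (H1_act phi u') (H1_act phi v')
        (H1_act phi (abcls x)) (jt phi).
  by move=> tE tE' x; have [s ss ->] := jt_chain phi; exact: key ss tE tE' x.
split=> [phi s ss|phi psi|phi phiT]; apply: eqC => u v u' v' x.
(* Both sums contract to theta' minus theta after [phi], an expression in which no chain occurs. *)
- have [[u1 <-] [v1 <-]] := (surj phi u, surj phi v).
  have [[u1' <-] [v1' <-]] := (surj phi u', surj phi v').
  have [y <-] := surj phi x; rewrite -(abclsK y).
  have [[theta tE] [theta' tE']] := (ex (H1_act phi u1) (H1_act phi v1)
    (H1_act phi u1') (H1_act phi v1'), ex u1 v1 u1' v1').
  have := jt_key phi _ _ _ _ _ _ tE tE' (repr y).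
  by rewrite (key phi s _ _ _ _ _ _ ss tE tE') => /addrI.
(* Three instances of [jt_key], for the product, [psi] and [phi], telescope; [contract_act] turns
   the contraction of [jt psi] into that of its image under [phi]. *)
- have [s [S ca _] _] := jt_chain phi.
  have [[u1 <-] [v1 <-]] := (surj (mcg_mul phi psi) u, surj (mcg_mul phi psi) v).
  have [[u1' <-] [v1' <-]] :=
    (surj (mcg_mul phi psi) u', surj (mcg_mul phi psi) v').
  have [y <-] := surj (mcg_mul phi psi) x; rewrite -(abclsK y).
  have [theta tE] := ex (H1_act (mcg_mul phi psi) u1) (H1_act (mcg_mul phi psi) v1)
    (H1_act (mcg_mul phi psi) u1') (H1_act (mcg_mul phi psi) v1').
  have [theta' tE'] := ex u1 v1 u1' v1'.
  have [theta'' tE''] := ex (H1_act psi u1) (H1_act psi v1) (H1_act psi u1')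
    (H1_act psi v1').
  have := jt_key _ _ _ _ _ _ _ tE tE' (repr y).
  rewrite (jt_key _ _ _ _ _ _ _ tE'' tE' (repr y)) pi1_act_mul.
  rewrite !H1_act_mul in tE *; rewrite (jt_key _ _ _ _ _ _ _ tE tE'') CD.
  rewrite /C (contract_act w_pairing _ _ _ _ _ _ ca) -!H1_act_abcls.
  by rewrite -addrA => /addrI <-.
(* As [phi] fixes H, one expansion serves both ends: its drop from x to [pi1_act phi x] is the
   contraction of [jt phi], and also 6 times that of [tau phi]. *)
have [theta tE] := ex u v u' v'.
have := jt_key phi u v u' v' theta theta.
rewrite !phiT => /(_ tE tE) /(_ (repr x)).
rewrite (expansion_johnson w_pairing (kA u v u' v') tE.1 _ phiT (tau_johnson phi phiT)).
rewrite phiT abclsK -/(C u v u' v' x) => tx.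
have -> : C u v u' v' x (jt phi) = 6 * C u v u' v' x (tau phi).
  by move: tx; move: (C _ _ _ _ _ _) (C _ _ _ _ _ _) => ? ?; lia.
by rewrite (pmulrn (tau phi) 6) (morphD_mulrz (CD u v u' v' x)) mulrzz mulrC.
Qed.
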